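(* Let $Z=\{P_1,\dots,P_r\}\subset\mathbb{P}^2$ be a finite set of points. If $\alpha(I(kZ))-\alpha(I((k-1)Z))=1$ for some integer $k\ge2$, then either (a) the points of $Z$ are collinear, or (b) $Z$ consists of all intersection points of some arrangement of lines (which might be non-reduced and degenerate, i.e. containing points through which more than two lines pass).
   Context: Work over an algebraically closed field $\mathbb{K}$ of characteristic zero, $R=\mathbb{K}[x_0,x_1,x_2]$. For $Z=\{P_1,\dots,P_r\}$, $I(P_i)$ is the homogeneous maximal ideal of $P_i$ and $I(kZ)=I(P_1)^k\cap\dots\cap I(P_r)^k$ (the $k$-th symbolic power of $I(Z)$). For a homogeneous ideal $J$, $\alpha(J)=\min\{n:J_n\ne0\}$ is its initial degree. *)

(* Defs.v *)
From HB Require Import structures.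
From mathcomp Require Import all_boot all_order all_algebra.
From mathcomp Require Import mpoly.
Set Implicit Arguments. Unset Strict Implicit. Unset Printing Implicit Defensive.
Import GRing.Theory.
Local Open Scope ring_scope.

Section Defs.
Variable K : fieldType.

(* Homogeneous coordinates of a point of P^2 (meaningful when nonzero). *)
Definition coords := 'I_3 -> K.

Definition nonzero_pt (P : coords) : Prop := exists i, P i != 0.

Definition same_pt (P Q : coords) : Prop :=
  exists c : K, c != 0 /\ forall i, Q i = c * P i.

(* A linear form vanishing at P: element of I(P)_1.  I(P) is generated by
   these linear forms. *)
Definition lin_at (P : coords) (l : {mpoly K[3]}) : Prop :=
  l \is 1.-homog /\ l.@[P] = 0.

Definition in_Ipow (P : coords) (k : nat) (f : {mpoly K[3]}) : Prop :=
  exists (m : nat) (g : 'I_m -> {mpoly K[3]}) (L : 'I_m -> 'I_k -> {mpoly K[3]}),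
    (forall j i, lin_at P (L j i)) /\
    f = \sum_(j < m) g j * \prod_(i < k) L j i.

Definition in_IkZ (r : nat) (Z : 'I_r -> coords) (k : nat) (f : {mpoly K[3]}) : Prop :=
  forall s : 'I_r, in_Ipow (Z s) k f.

Definition is_alpha (J : {mpoly K[3]} -> Prop) (d : nat) : Prop :=
  (exists f, f != 0 /\ f \is d.-homog /\ J f) /\
  (forall n f, (n < d)%N -> f \is n.-homog -> J f -> f = 0).

Definition collinear (r : nat) (Z : 'I_r -> coords) : Prop :=
  exists l : {mpoly K[3]}, l != 0 /\ l \is 1.-homog /\ forall s, l.@[Z s] = 0.

Definition is_line (l : {mpoly K[3]}) : Prop := l != 0 /\ l \is 1.-homog.

Definition same_line (l l' : {mpoly K[3]}) : Prop :=
  exists c : K, c != 0 /\ l' = c *: l.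

Definition intersection_pt (m : nat) (L : 'I_m -> {mpoly K[3]}) (P : coords) : Prop :=
  exists i j, ~ same_line (L i) (L j) /\ (L i).@[P] = 0 /\ (L j).@[P] = 0.

Definition is_intersection_set (r : nat) (Z : 'I_r -> coords)
    (m : nat) (L : 'I_m -> {mpoly K[3]}) : Prop :=
  (forall i, is_line (L i)) /\
  (forall s, intersection_pt L (Z s)) /\
  (forall P, nonzero_pt P -> intersection_pt L P -> exists s, same_pt (Z s) P).

End Defs.

(* Main.v *)
Require Import Defs.
From HB Require Import structures.
From mathcomp Require Import all_boot all_order all_algebra.
From mathcomp Require Import mpoly.
From mathcomp Require Import all_fingroup zify ring.
From Stdlib Require Import Classical.
Set Implicit Arguments. Unset Strict Implicit. Unset Printing Implicit Defensive.
Import GRing.Theory.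
Local Open Scope ring_scope.

(** The idea: take a form [f] of degree [a + 1] in the ideal of [kZ].  If [C] is
    an irreducible factor of [f] of degree [d >= 2], with multiplicities [m_P] at
    the points [P] of [Z], then Bezout's inequality applied to [C] and to its
    derivative along a tangent direction at a further point of [C] gives
    [sum m_P (m_P - 1) < d (d - 1)].  By a dimension count there is then a form
    [H] of degree [d - 2] with multiplicity at least [m_P - 1] at each [P], and
    [f / C * H] has degree [a - 1] and lies in the ideal of [(k - 1)Z], which is
    impossible.  So [f] is a product of lines.  For the same reason two distinct
    lines [l, l'] of [f] meet at a point of [Z] lying on at most [k] of the lines:
    otherwise [f / (l l')] contradicts minimality.  If some point of [Z] is on one
    line [l] only, then [l] occurs at least [k] times, so a line [l'] other than
    [l] would meet it at a point on more than [k] lines; hence [f] is a power of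
    [l] up to a scalar, and [Z] is contained in [l].

    The curves are studied in an affine chart containing [Z], as elements of
    [{poly {poly K}}]: the inner variable is [x], the outer one [y]. *)

(** * Determinants with weighted entries *)

(** Every term of the Leibniz expansion takes one entry from each row and each column, so the row
    weights [w] and the column weights [v] add up to the same totals in all terms. With [Q] read as
    a degree bound or as divisibility by powers, this serves both the global and the local estimate
    of a resultant. *)
Lemma det_weighted (R : comNzRingType) (Q : nat -> R -> Prop) (x : R) n
    (M : 'M[R]_n) (w v : 'I_n -> nat) :
  (forall d, Q d 0) -> (forall d a b, Q d a -> Q d b -> Q d (a + b)) ->
  (forall d a, Q d a -> Q d (- a)) ->
  Q 0 1 -> (forall d e a b, Q d a -> Q e b -> Q (d + e)%N (a * b)) ->
  (forall i j, Q (w i) (M i j * x ^+ v j)) ->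
  Q (\sum_i w i)%N (\det M * x ^+ \sum_i v i).
Proof.
move=> Q0 QD QN Q1 QM QMij; rewrite /determinant big_distrl /=.
apply: (big_ind (Q (\sum_i w i)%N)) => // [a b|s _]; first exact: QD.
rewrite [X in x ^+ X](reindex_inj (@perm_inj _ s)) /= -prodrXr -mulrA -big_split /=.
have Qs : Q (\sum_i w i)%N (\prod_i (M i (s i) * x ^+ v (s i))).
  by apply: (big_ind2 Q) => // d a e b; apply: QM.
by rewrite mulr_sign; case: ifP => // _; apply: QN.
Qed.

Lemma size_det_weighted (K : idomainType) n (M : 'M[{poly K}]_n) (w v : 'I_n -> nat) :
  (forall i j, size (M i j * 'X^(v j))%R <= (w i).+1)%N ->
  (size (\det M) + \sum_i v i <= (\sum_i w i).+1)%N \/ \det M = 0.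
Proof.
move=> sM; have [->|nzM] := eqVneq (\det M) 0; [by right | left].
suff: (size (\det M * 'X^(\sum_i v i))%R <= (\sum_i w i).+1)%N.
  by rewrite size_mulXn // addnC.
apply: (@det_weighted _ (fun d (p : {poly K}) => size p <= d.+1)%N) => //.
- by move=> d; rewrite size_poly0.
- by move=> d a b sa sb; rewrite (leq_trans (size_polyD _ _)) // geq_max sa.
- by move=> d a; rewrite size_polyN.
- by rewrite size_poly1.
- move=> d e a b sa sb; apply: leq_trans (size_polyMleq _ _) _; lia.
Qed.

Lemma dvdp_det_weighted (K : fieldType) (pi : {poly K}) n (M : 'M[{poly K}]_n)
    (w v : 'I_n -> nat) d :
  pi != 0 -> (forall i j, pi ^+ w i %| M i j * pi ^+ v j) ->
  (d + \sum_i v i <= \sum_i w i)%N -> pi ^+ d %| \det M.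
Proof.
move=> nzpi dM le_d.
suff: pi ^+ (\sum_i w i) %| \det M * pi ^+ (\sum_i v i).
  move=> /(dvdp_trans (dvdp_exp2l pi le_d)); rewrite exprD dvdp_mul2r //.
  by rewrite expf_eq0 (negPf nzpi) andbF.
apply: (@det_weighted _ (fun d (p : {poly K}) => pi ^+ d %| p)) => //.
- by move=> e a b; apply: dvdp_add.
- by move=> e a; rewrite dvdpNr.
- by move=> e1 e2 a b; rewrite exprD; apply: dvdp_mul.
Qed.

(** Compares the row and column weights of [dvdp_resultant]. For [c = m] the two sides agree; each
    further column costs at most [m + n], which is what the further row brings. *)
Lemma sum_weights_resultant (c e m n : nat) : (m <= c)%N ->
  (m * n + \sum_(j < e + c) minn j (m + n) <=
   \sum_(k < e) (m + minn k n) + \sum_(k < c) (n + minn k m))%N.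
Proof.
move=> /subnKC <-; elim: (c - m)%N => [|c' IHc]; last first.
  rewrite !addnS !big_ord_recr /=; move: IHc.
  set s1 := (\sum_(j < e + (m + c')) _)%N; set s2 := (\sum_(k < e) _)%N.
  by set s3 := (\sum_(k < m + c') _)%N; lia.
rewrite addn0 (addnC e) big_split_ord /= addnA addnC leq_add //.
  by apply: leq_sum => k _; lia.
rewrite big_split /= sum_nat_const card_ord leq_add2l leq_sum // => k _.
by have := ltn_ord k; lia.
Qed.

Lemma sum_weights_degree (c e c' e' : nat) : (c' <= c)%N -> (e' <= e)%N ->
  (\sum_(k < e') (c + k) + \sum_(k < c') (e + k) <=
   c * e + \sum_(j < e' + c') j)%N.
Proof.
move=> lec lee; rewrite big_split_ord /= !big_split /= !sum_nat_const !card_ord.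
have := leq_mul lec (leqnn (e - e')).
set s1 := (\sum_(k < e') _)%N; set s2 := (\sum_(k < c') _)%N; nia.
Qed.

(** * Bezout's inequality *)

Section SylvesterShift.
Variable R : comNzRingType.
Implicit Types (p q : {poly R}) (a : R).

Definition band_mx d n p : 'M[R]_(d, n) := lin1_mx (poly_rV \o p \o* rVpoly).

(** When [c] and [e] are the degrees of [p] and [q], the determinant is [resultant p q] by
    conversion. As parameters, the sizes stay fixed under substitution in [p] and [q]. *)
Definition sylvester e c p q : 'M[R]_(e + c) :=
  col_mx (band_mx e (e + c) p) (band_mx c (e + c) q).

Lemma sylvesterE e c p q (i j : 'I_(e + c)) :
  sylvester e c p q i j = match split i with
    | inl k => p`_(j - k) *+ (k <= j)%N | inr k => q`_(j - k) *+ (k <= j)%N end.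
Proof.
rewrite mxE; case: (split i) => k; rewrite !mxE /=;
  by rewrite rVpoly_delta coefXnM ltnNge if_neg -mulrb.
Qed.

Definition shift_mx n a : 'M[R]_n := \matrix_(i < n) poly_rV (('X + a%:P) ^+ i).

Lemma mul_shift_mx n a (v : 'rV[R]_n) :
  v *m shift_mx n a = poly_rV (rVpoly v \Po ('X + a%:P)).
Proof.
rewrite mulmx_sum_row /rVpoly poly_def !linear_sum /=.
apply: eq_bigr => i _; rewrite rowK !linearZ /= comp_Xn_poly insubT //=.
by move=> lt_i; congr (_ *: _); congr (v _ _); apply: val_inj.
Qed.

Lemma det_shift_mx n a : \det (shift_mx n a) = 1.
Proof.
have szX (i : nat) : size (('X + a%:P) ^+ i) = i.+1.
  by rewrite -[a]opprK polyCN size_exp_XsubC.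
rewrite det_trig.
  rewrite big1 // => i _; rewrite !mxE.
  have /monicP := monic_exp i (monicXsubC (- a)).
  by rewrite polyCN opprK lead_coefE szX.
by apply/is_trig_mxP => i j ltij; rewrite !mxE nth_default ?szX.
Qed.

(** The rows are the multiples of [p] and [q] by powers of the variable, and substituting ['X + a]
    acts on rows and columns through [shift_mx], which is unitriangular. This moves a point to
    ordinate 0 without changing the resultant. *)
Lemma det_sylvester_shift e c p q a : (size p <= c.+1)%N -> (size q <= e.+1)%N ->
  \det (sylvester e c p q) =
  \det (sylvester e c (p \Po ('X + a%:P)) (q \Po ('X + a%:P))).
Proof.
move=> sp sq; pose X := 'X + a%:P.
have band_shift d n (r : {poly R}) : (size r + d <= n.+1)%N ->
    band_mx d n r *m shift_mx n a = shift_mx d a *m band_mx d n (r \Po X).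
  move=> sr; apply/row_matrixP => i; rewrite !row_mul rowE mul_rV_lin1 /=.
  rewrite mul_rV_lin1 /= mul_shift_mx rowK rVpoly_delta.
  rewrite !poly_rV_K ?rmorphM /= ?comp_Xn_poly //.
    rewrite -[a]opprK polyCN size_exp_XsubC.
    exact: ltn_ord.
  rewrite (leq_trans (size_polyMleq _ _)) // size_polyXn.
  by have := ltn_ord i; lia.
have : sylvester e c p q *m shift_mx (e + c) a =
    block_mx (shift_mx e a) 0 0 (shift_mx c a) *m sylvester e c (p \Po X) (q \Po X).
  rewrite /sylvester mul_col_mx mul_block_col !mul0mx addr0 add0r.
  by rewrite !band_shift //; lia.
move/(congr1 (@determinant _ _)); rewrite !det_mulmx det_ublock !det_shift_mx.
by rewrite !mulr1 mul1r.
Qed.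

End SylvesterShift.

Lemma coef_comp_polyCMX (R : comNzRingType) (A : {poly R}) c j :
  (A \Po (c%:P * 'X))`_j = A`_j * c ^+ j.
Proof.
rewrite coef_comp_poly; under eq_bigr => i _ do rewrite exprMn -polyC_exp coefCM coefXn.
have [ltjA|leAj] := ltnP j (size A).
  rewrite (bigD1 (Ordinal ltjA)) //= eqxx mulr1 big1 ?addr0 // => i /eqP ne.
  by case: eqP => [e|]; [case: ne; apply: val_inj | rewrite !mulr0].
rewrite nth_default // mul0r big1 // => i _; rewrite gtn_eqF ?mulr0 //.
exact: leq_trans leAj.
Qed.

(** * Total degree, multiplicity and resultants of plane curves *)

Section Bivariate.
Variable K : fieldType.
Local Notation bipoly := {poly {poly K}}.
Implicit Types (A B C G : bipoly) (p : K * K).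

(* Total degree plus one: substituting [x t] for [x] and [y t] for [y] amounts,
   up to renaming, to substituting [x y] for [y] and looking at the degree in [x]. *)
Definition tdsize A := sizeY (A \Po ('X%:P * 'X)).

Lemma tdsize_leP n A :
  reflect (forall j, size (A`_j * 'X^j)%R <= n)%N (tdsize A <= n)%N.
Proof.
apply: (iffP idP) => [le_n j | le_n].
  by rewrite -coef_comp_polyCMX (leq_trans (max_size_coefXY _ _)).
by apply/bigmax_leqP => j _; rewrite coef_comp_polyCMX.
Qed.

Lemma tdsize_coef A j : (size (A`_j * 'X^j)%R <= tdsize A)%N.
Proof. by have /tdsize_leP := leqnn (tdsize A). Qed.

Lemma tdsize_eq0 A : (tdsize A == 0)%N = (A == 0).
Proof.
apply/idP/eqP => [|->]; last by rewrite sizeY_eq0 comp_poly0.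
rewrite -leqn0 => /tdsize_leP A0; apply/polyP => j; rewrite coef0; apply/eqP.
by have := A0 j; rewrite leqn0 size_poly_eq0 mulf_eq0 expf_eq0 polyX_eq0 andbF orbF.
Qed.

Lemma tdsize0 : tdsize 0 = 0%N.
Proof. by apply/eqP; rewrite tdsize_eq0. Qed.

Lemma tdsize_gt0 A : A != 0 -> (0 < tdsize A)%N.
Proof. by rewrite lt0n tdsize_eq0. Qed.

Lemma tdsizeM A B : A != 0 -> B != 0 -> tdsize (A * B) = (tdsize A + tdsize B).-1.
Proof.
rewrite -(tdsize_eq0 A) -(tdsize_eq0 B) /tdsize !sizeYE !rmorphM /= !size_poly_eq0 => nA nB.
by rewrite size_mul.
Qed.

Lemma tdsizeD A B n : (tdsize A <= n -> tdsize B <= n -> tdsize (A + B)%R <= n)%N.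
Proof.
rewrite /tdsize !sizeYE !rmorphD /= => sA sB.
by rewrite (leq_trans (size_polyD _ _)) // geq_max sA.
Qed.

Lemma size_le_tdsize A : (size A <= tdsize A)%N.
Proof.
have [->|nzA] := eqVneq A 0; first by rewrite size_poly0.
have := tdsize_coef A (size A).-1; rewrite -lead_coefE size_mulXn ?lead_coef_eq0 //.
have := size_poly_gt0 (lead_coef A); rewrite lead_coef_eq0 nzA.
have := size_poly_gt0 A; rewrite nzA; lia.
Qed.

Definition linX (a : K) : {poly K} := 'X - a%:P.

Definition blowup p A := A \Po ((linX p.1)%:P * 'X + p.2%:P%:P).

Definition shiftY (b : K) A := A \Po ('X + b%:P%:P).

(* The multiplicity of [A] at [p] is read off as the order of vanishing along
   the exceptional line of the blow-up chart [(x, y) -> (x, p.2 + (x - p.1) y)]. *)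
Definition mult_ge p k A := all (dvdp (linX p.1 ^+ k)) (blowup p A).

Lemma linX_neq0 a : linX a != 0. Proof. by rewrite polyXsubC_eq0. Qed.

Lemma coef_blowup p A j : (blowup p A)`_j = (shiftY p.2 A)`_j * linX p.1 ^+ j.
Proof.
by rewrite -coef_comp_polyCMX /shiftY -comp_polyA comp_polyD comp_polyX comp_polyC.
Qed.

Lemma mult_geP p k A :
  reflect (forall j, linX p.1 ^+ k %| (shiftY p.2 A)`_j * linX p.1 ^+ j)
    (mult_ge p k A).
Proof.
apply: (iffP (all_nthP 0)) => H j => [|_]; last by rewrite coef_blowup.
rewrite -coef_blowup; have [/H //|le] := ltnP j (size (blowup p A)).
by rewrite nth_default ?dvdp0.
Qed.

(** In coordinates centred at [p], multiplicity [m] makes the coefficient of [y^l] divisible by the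
    power [m - l] of [linX p.1]; truncated subtraction makes this void for [l > m]. The spare
    exponent [v] is a column weight of the Sylvester matrix. *)
Lemma mult_ge_coef p m A l v w : mult_ge p m A -> (w <= (m - l) + v)%N ->
  linX p.1 ^+ w %| (shiftY p.2 A)`_l * linX p.1 ^+ v.
Proof.
move=> /mult_geP /(_ l) dA le_w; apply: dvdp_trans (dvdp_exp2l _ le_w) _.
rewrite exprD dvdp_mul //; have [le_lm|/ltnW] := leqP l m; last first.
  by rewrite -subn_eq0 => /eqP ->; rewrite expr0 dvd1p.
rewrite -(dvdp_mul2r _ _ (expf_neq0 l (linX_neq0 p.1))) -exprD subnK //.
Qed.

Lemma size_shiftY b A : size (shiftY b A) = size A.
Proof. by rewrite size_comp_poly2 // size_XaddC. Qed.

(** The local half of Bezout: after translating [p] to ordinate 0, the entries of the Sylvester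
    matrix are divisible by powers of [linX p.1] that suit [dvdp_det_weighted]. *)
Lemma dvdp_resultant p m n C G : (m <= (size C).-1)%N ->
  mult_ge p m C -> mult_ge p n G -> linX p.1 ^+ (m * n) %| resultant C G.
Proof.
set c := (size C).-1; set e := (size G).-1 => le_mc mC nG.
have -> : resultant C G = \det (sylvester e c (shiftY p.2 C) (shiftY p.2 G)).
  by rewrite -det_sylvester_shift ?leqSpred.
(* The caps on the weights matter: with row weights [m + k], [n + k] and column weights [j] the gain
   would be only [m e + n c - e c], short of [m n] by [(c - m)(e - n)]. *)
pose w (i : 'I_(e + c)) :=
  match split i with inl k => m + minn k n | inr k => n + minn k m end%N.
apply: (@dvdp_det_weighted _ _ _ _ w (fun j => minn j (m + n))) => [|i j|].
- exact: linX_neq0.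
- rewrite sylvesterE /w; case: (split i) => k.
    have [lekj|_] := leqP k j; last by rewrite mul0r dvdp0.
    by rewrite mulr1n (mult_ge_coef mC) //; lia.
  have [lekj|_] := leqP k j; last by rewrite mul0r dvdp0.
  by rewrite mulr1n (mult_ge_coef nG) //; lia.
rewrite [X in (_ <= X)%N]big_split_ord /=.
under [X in (_ <= X + _)%N]eq_bigr => k _ do rewrite /w -[lshift _ _]/(unsplit (inl k)) unsplitK.
under [X in (_ <= _ + X)%N]eq_bigr => k _ do rewrite /w -[rshift _ _]/(unsplit (inr k)) unsplitK.
exact: sum_weights_resultant.
Qed.

(** The global half of Bezout: once column [j] is multiplied by [x^j], row [k] of either block has
    degree at most [c + k] or [e + k]. The degrees in [y] may be smaller than [c] and [e], which
    [sum_weights_degree] allows. *)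
Lemma size_resultant_le c e C G : (tdsize C <= c.+1)%N -> (tdsize G <= e.+1)%N ->
  (size (resultant C G) <= (c * e).+1)%N.
Proof.
move=> sC sG; set c' := (size C).-1; set e' := (size G).-1.
have lec : (c' <= c)%N by have := size_le_tdsize C; rewrite /c'; lia.
have lee : (e' <= e)%N by have := size_le_tdsize G; rewrite /e'; lia.
rewrite -[resultant C G]/(\det (sylvester e' c' C G)).
pose w (i : 'I_(e' + c')) := match split i with inl k => c + k | inr k => e + k end%N.
have coef_size A d (k : nat) (j : nat) : (tdsize A <= d.+1)%N -> (k <= j)%N ->
    (size (A`_(j - k) * 'X^j)%R <= (d + k).+1)%N.
  move=> sA lekj; rewrite -{2}(subnK lekj) exprD mulrA.
  have sAk := leq_trans (tdsize_coef A (j - k)) sA.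
  have [->|nz] := eqVneq (A`_(j - k) * 'X^(j - k)) 0; first by rewrite mul0r size_poly0.
  by rewrite size_mulXn //; move: sAk; lia.
case: (@size_det_weighted _ _ (sylvester e' c' C G) w (fun j => j : nat)) => [i j||->].
- rewrite sylvesterE /w; case: (split i) => k.
    by have [lekj|_] := leqP k j; rewrite ?mul0r ?size_poly0 // mulr1n coef_size.
  by have [lekj|_] := leqP k j; rewrite ?mul0r ?size_poly0 // mulr1n coef_size.
- rewrite [X in (_ <= X.+1)%N]big_split_ord /=.
  under [X in (_ <= (X + _).+1)%N]eq_bigr => k _ do rewrite /w -[lshift _ _]/(unsplit (inl k)) unsplitK.
  under [X in (_ <= (_ + X).+1)%N]eq_bigr => k _ do rewrite /w -[rshift _ _]/(unsplit (inr k)) unsplitK.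
  have := sum_weights_degree lec lee.
  set s1 := (\sum_(k < e') _)%N; set s2 := (\sum_(k < c') _)%N.
  set s3 := (\sum_(k < e' + c') _)%N; move: (size _) (c * e)%N; lia.
by rewrite size_poly0.
Qed.

(** Points with distinct abscissas give pairwise coprime powers of [linX], so their product divides
    the nonzero resultant, whose degree is at most [c * e]. *)
Lemma bezout_multiplicities c e C G (s : seq (K * K)) (m n : K * K -> nat) :
  (tdsize C <= c.+1)%N -> (tdsize G <= e.+1)%N -> resultant C G != 0 ->
  uniq (map fst s) -> {in s, forall p, m p <= (size C).-1}%N ->
  {in s, forall p, mult_ge p (m p) C} -> {in s, forall p, mult_ge p (n p) G} ->
  (\sum_(p <- s) m p * n p <= c * e)%N.
Proof.
move=> sC sG nzR us mle mC nG; rewrite -ltnS.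
apply: leq_trans (size_resultant_le sC sG).
suff dR : \prod_(p <- s) linX p.1 ^+ (m p * n p) %| resultant C G.
  apply: leq_trans (dvdp_leq nzR dR); apply: eq_leq.
  elim: s {us mle mC nG dR} => [|p s IHs]; first by rewrite !big_nil size_poly1.
  rewrite !big_cons size_Mmonic; last 2 first.
  - exact: expf_neq0 (linX_neq0 _).
  - by apply: monic_prod => i _; apply/monic_exp/monicXsubC.
  by rewrite size_exp_XsubC -IHs addSn /= addnS.
elim: s us mle mC nG => [|p s IHs] /=; first by rewrite big_nil dvd1p.
case/andP=> ps us mle mC nG; rewrite big_cons.
have sub (q : K * K) : q \in s -> q \in p :: s by rewrite inE => ->; rewrite orbT.
rewrite Gauss_dvdp; last first.
  rewrite coprimep_expl // big_seq; apply: (big_ind (coprimep _)) => [|a b|q qs].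
  - exact: coprimep1.
  - by rewrite coprimepMr => -> ->.
  apply: coprimep_expr; rewrite coprimep_XsubC root_XsubC.
  by apply: contra ps => /eqP <-; apply: map_f.
rewrite dvdp_resultant ?IHs //; try by move=> q /sub; auto.
- by apply: mle; rewrite mem_head.
- by apply: mC; rewrite mem_head.
by apply: nG; rewrite mem_head.
Qed.

End Bivariate.

(** * Interpolation by counting conditions *)

Lemma kernel_exists (K : fieldType) (I J : finType) (A : I -> J -> K) :
  (#|J| < #|I|)%N ->
  exists2 v : I -> K, exists i, v i != 0 & forall j, \sum_i v i * A i j = 0.
Proof.
move=> ltJI; pose M := \matrix_(i < #|I|, j < #|J|) A (enum_val i) (enum_val j).
have /rowV0Pn[v /sub_kermxP vM /rV0Pn[i0 nz]] : kermx M != 0.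
  by rewrite -mxrank_eq0 mxrank_ker; have := rank_leq_col M; lia.
exists (fun i => v 0 (enum_rank i)); first by exists (enum_val i0); rewrite enum_valK.
move=> j; have /rowP/(_ (enum_rank j)) := vM; rewrite !mxE => {2}<-.
rewrite (reindex (@enum_val I predT)) /=; last first.
  by exists enum_rank => i _; rewrite ?enum_valK ?enum_rankK.
by apply: eq_bigr => i _; rewrite mxE enum_valK enum_rankK.
Qed.

Section Counting.
Variable K : fieldType.
Local Notation bipoly := {poly {poly K}}.

Lemma card_triangle d : (#|{: {j : 'I_d & 'I_(d - j)}}| * 2 = d * d.+1)%N.
Proof.
rewrite card_tagged sumnE big_map big_enum /=.
under eq_bigr => j _ do rewrite card_ord.
have -> : (\sum_(j < d) (d - j) = \sum_(j < d) j.+1)%N.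
  by rewrite (reindex_inj rev_ord_inj); apply: eq_bigr => j _ /=; have := ltn_ord j; lia.
elim: d => [|d IHd]; first by rewrite big_ord0.
by rewrite big_ord_recr /= mulnDl IHd; lia.
Qed.

(** For [j + l < k] these are the Taylor conditions for multiplicity [k] at [p], which number
    [k (k + 1) / 2]. They are taken as remainders, which are linear in [A]. *)
Definition jet_coef (p : K * K) k j l (A : bipoly) : K :=
  ((shiftY p.2 A)`_j %% linX p.1 ^+ (k - j))`_l.

Lemma mult_ge_jet p k A :
  (forall j l, (j < k)%N -> (l < k - j)%N -> jet_coef p k j l A = 0) -> mult_ge p k A.
Proof.
move=> jA; apply/mult_geP => j; have [ltjk|lekj] := ltnP j k; last first.
  by rewrite dvdp_mull // dvdp_exp2l.
rewrite -{1}(subnK (ltnW ltjk)) exprD dvdp_mul2r ?expf_neq0 ?linX_neq0 //.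
apply/modp_eq0P/polyP => l; rewrite coef0.
have [ltl|lel] := ltnP l (k - j); first exact: jA.
have := ltn_modp (shiftY p.2 A)`_j (linX p.1 ^+ (k - j)).
rewrite expf_neq0 ?linX_neq0 // size_exp_XsubC ltnS => /leq_trans/(_ lel).
exact: nth_default.
Qed.

Lemma jet_coef_lin p k j l (I : finType) (v : I -> K) (e : I -> bipoly) :
  jet_coef p k j l (\sum_i (v i)%:P%:P * e i) = \sum_i v i * jet_coef p k j l (e i).
Proof.
rewrite /jet_coef /shiftY rmorph_sum coef_sum /= (big_morph _ (modpD _) (mod0p _)) coef_sum.
apply: eq_bigr => i _.
by rewrite rmorphM /= comp_polyC coefCM mul_polyC modpZl coefZ.
Qed.

(** There are [d (d + 1) / 2] monomials of degree below [d], more than the linear conditions imposed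
    at the points; the hypothesis is this comparison doubled. *)
Lemma interpolation_exists (s : seq (K * K)) (n : K * K -> nat) d :
  (\sum_(p <- s) n p * (n p).+1 < d * d.+1)%N ->
  exists H : bipoly, [/\ H != 0, (tdsize H <= d)%N &
    {in s, forall p, mult_ge p (n p) H}].
Proof.
move=> lt_d; pose I := {j : 'I_d & 'I_(d - j)}.
pose pt (t : 'I_(size s)) := tnth (in_tuple s) t.
pose J := {t : 'I_(size s) & {j : 'I_(n (pt t)) & 'I_(n (pt t) - j)}}.
pose e (t : I) : bipoly := ('X^(tagged t))%:P * 'X^(tag t).
pose jet (t : J) (A : bipoly) :=
  jet_coef (pt (tag t)) (n (pt (tag t))) (tag (tagged t)) (tagged (tagged t)) A.
have ltJI : (#|{: J}| < #|{: I}|)%N.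
  rewrite -(ltn_pmul2r (isT : 0 < 2)%N) card_triangle; apply: leq_trans lt_d.
  rewrite ltnS card_tagged sumnE big_map big_enum /= big_distrl /=.
  rewrite [X in (_ <= X)%N]big_tnth.
  by apply: leq_sum => t _; rewrite card_triangle.
have [v [t0 nz_v] vJ] := kernel_exists (fun i j => jet j (e i)) ltJI.
exists (\sum_t (v t)%:P%:P * e t); split.
- have coefE : (\sum_t (v t)%:P%:P * e t)`_(tag t0)`_(tagged t0) = v t0.
    rewrite !coef_sum (bigD1 t0) //= big1 ?addr0 => [|t ne_t].
      by rewrite /e !coefCM coefXn eqxx mulr1 coefXn eqxx mulr1.
    rewrite /e !coefCM coefXn; case: eqP => [e1|]; last by rewrite mulr0 coef0 mulr0.
    rewrite mulr1 coefXn; case: eqP => [e2|]; last by rewrite mulr0.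
    case/eqP: ne_t; case: t t0 e1 e2 {nz_v} => [j i] [j0 i0] /= /val_inj ej.
    by subst j0 => /val_inj ->.
  by apply: contraNneq nz_v => s0; rewrite -coefE s0 !coef0.
- apply: (big_ind (fun A => tdsize A <= d)%N) => [|A B|t _].
  + by rewrite tdsize0.
  + exact: tdsizeD.
  apply/tdsize_leP => j; rewrite /e !coefCM coefXn.
  have [->|_] := eqVneq j (tag t); last by rewrite !mulr0 mul0r size_poly0.
  rewrite mulr1 -mulrA mul_polyC (leq_trans (size_scale_leq _ _)) //.
  by rewrite -exprD size_polyXn addnC -ltn_subRL.
move=> p /(tnthP (in_tuple s))[t ->]; apply: mult_ge_jet => j l ltj ltl; rewrite jet_coef_lin.
exact: (vJ (existT _ t (existT _ (Ordinal ltj) (Ordinal ltl)))).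
Qed.

End Counting.

(** * Multiplicities *)

Section Content.
Variable K : fieldType.
Local Notation bipoly := {poly {poly K}}.
Implicit Types (A B C : bipoly) (p : K * K) (d : {poly K}).

Definition cdvd d A := all (dvdp d) A.

Lemma cdvdP d A : reflect (exists B, A = d%:P * B) (cdvd d A).
Proof.
apply: (iffP (all_nthP 0)) => [dA|[B ->] j _]; last by rewrite coefCM dvdp_mulr.
exists (\poly_(j < size A) (A`_j %/ d)); apply/polyP => j.
rewrite coefCM coef_poly; case: ltnP => [/dA dAj|leAj]; last by rewrite mulr0 nth_default.
by rewrite mulrC divpK.
Qed.

Lemma cdvdE a A : cdvd (linX a) A = (map_poly (horner_eval a) A == 0).
Proof.
apply/cdvdP/eqP => [[B ->]|A0].
  by rewrite rmorphM /= map_polyC /= horner_evalE hornerXsubC subrr mul0r.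
apply/cdvdP/(all_nthP 0) => j _; rewrite dvdp_XsubCl.
by have := congr1 (fun q : {poly K} => q`_j) A0; rewrite coef0 coef_map => /eqP.
Qed.

(** Setting [x = a] maps to an integral domain, so [linX a] is prime. *)
Lemma cdvd_linXM a A B : cdvd (linX a) (A * B) = cdvd (linX a) A || cdvd (linX a) B.
Proof. by rewrite !cdvdE rmorphM mulf_eq0. Qed.

Lemma cdvd_linX_cancel a k A B : ~~ cdvd (linX a) A ->
  cdvd (linX a ^+ k) (A * B) -> cdvd (linX a ^+ k) B.
Proof.
move=> ndA; elim: k B => [|k IHk] B; first by move=> _; apply/cdvdP; exists B; rewrite mul1r.
case/cdvdP=> W eW; have : cdvd (linX a) (A * B).
  by apply/cdvdP; exists ((linX a ^+ k)%:P * W); rewrite eW exprS polyCM mulrA.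
rewrite cdvd_linXM (negPf ndA) /= => /cdvdP[B' eB].
suff /IHk/cdvdP[B'' eB'] : cdvd (linX a ^+ k) (A * B').
  by rewrite eB eB'; apply/cdvdP; exists B''; rewrite exprS polyCM mulrA.
apply/cdvdP; exists W; apply: (mulfI (_ : (linX a)%:P != 0)).
  by rewrite polyC_eq0 linX_neq0.
by rewrite mulrCA -eB eW exprS polyCM mulrA.
Qed.

Lemma mult_geE p k A : mult_ge p k A = cdvd (linX p.1 ^+ k) (blowup p A).
Proof. by []. Qed.

Lemma blowupM p A B : blowup p (A * B) = blowup p A * blowup p B.
Proof. exact: rmorphM. Qed.

Lemma mult_ge0 p A : mult_ge p 0 A.
Proof. by rewrite mult_geE; apply/cdvdP; exists (blowup p A); rewrite mul1r. Qed.

Lemma mult_geS p k l A : (l <= k)%N -> mult_ge p k A -> mult_ge p l A.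
Proof.
rewrite !mult_geE => lelk /cdvdP[B ->]; apply/cdvdP.
by exists ((linX p.1 ^+ (k - l))%:P * B); rewrite mulrA -polyCM -exprD subnKC.
Qed.

Lemma mult_geM p k l A B :
  mult_ge p k A -> mult_ge p l B -> mult_ge p (k + l) (A * B).
Proof.
rewrite !mult_geE blowupM => /cdvdP[A' ->] /cdvdP[B' ->]; apply/cdvdP.
by exists (A' * B'); rewrite exprD polyCM mulrACA.
Qed.

Lemma mult_geD p k A B : mult_ge p k A -> mult_ge p k B -> mult_ge p k (A + B).
Proof.
rewrite !mult_geE => /cdvdP[A' eA] /cdvdP[B' eB]; apply/cdvdP.
by exists (A' + B'); rewrite /blowup comp_polyD -!/(blowup _ _) eA eB mulrDr.
Qed.

Lemma mult_ge_mull p k A B : mult_ge p k B -> mult_ge p k (A * B).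
Proof. exact: mult_geM (mult_ge0 p A). Qed.

Lemma blowup_eq0 p A : (blowup p A == 0) = (A == 0).
Proof.
apply: comp_poly2_eq0; rewrite size_MXaddC polyC_eq0 (negPf (linX_neq0 _)) /=.
by rewrite size_polyC linX_neq0.
Qed.

(** The multiplicity is a valuation, the order along the exceptional line. Once the exact power is
    removed from the blow-up of [A], what remains is prime to that line and can be cancelled. *)
Lemma mult_ge_cancel p m k A B : mult_ge p m A -> ~~ mult_ge p m.+1 A ->
  mult_ge p k (A * B) -> mult_ge p (k - m) B.
Proof.
rewrite !mult_geE blowupM => /cdvdP[A' eA] nA; have nz := linX_neq0 p.1.
have {nA} nA' : ~~ cdvd (linX p.1) A'.
  apply: contra nA => /cdvdP[A'' eA']; apply/cdvdP; exists A''.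
  by rewrite eA eA' exprSr polyCM mulrA.
have [lekm _|/ltnW lemk] := leqP k m.
  by move: lekm; rewrite -subn_eq0 => /eqP ->; apply: mult_ge0.
case/cdvdP => W eW; apply: cdvd_linX_cancel nA' _; apply/cdvdP; exists W.
apply: (mulfI (_ : (linX p.1 ^+ m)%:P != 0)); first by rewrite polyC_eq0 expf_neq0.
by rewrite mulrA -eA eW mulrA -polyCM -exprD subnKC.
Qed.

Lemma mult_ge_bounded p A : A != 0 -> exists n, ~~ mult_ge p n.+1 A.
Proof.
rewrite -(blowup_eq0 p) -lead_coef_eq0 => nzA; exists (size (lead_coef (blowup p A))).
apply/negP => /(all_nthP 0) /(_ (size (blowup p A)).-1).
rewrite -lead_coefE prednK ?leqnn; last by rewrite size_poly_gt0 -lead_coef_eq0.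
by move=> /(_ isT) /(dvdp_leq nzA); rewrite size_exp_XsubC ltnNge leqnSn.
Qed.

Lemma mult_exists A : A != 0 ->
  exists m : K * K -> nat, forall p, mult_ge p (m p) A && ~~ mult_ge p (m p).+1 A.
Proof.
move=> nzA; exists (fun p => ex_minn (mult_ge_bounded p nzA)) => p.
case: ex_minnP => -[|m] -> min_m; rewrite andbT; first exact: mult_ge0.
by apply: contraTT isT => /min_m; rewrite ltnn.
Qed.

Lemma mult_ge1 p A : mult_ge p 1 A = (A.[p.2%:P].[p.1] == 0).
Proof.
rewrite mult_geE expr1 cdvdE; have -> : map_poly (horner_eval p.1) (blowup p A) =
    (A.[p.2%:P].[p.1])%:P; last by rewrite polyC_eq0.
rewrite map_comp_poly rmorphD rmorphM /= !map_polyC /= !horner_evalE.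
rewrite hornerXsubC subrr mul0r add0r comp_polyCr hornerC.
by congr (_%:P); rewrite -[RHS]horner_evalE -[RHS]horner_map /= horner_evalE hornerC.
Qed.

End Content.

(** * Derivatives and the Gauss lemma *)

Section Derivatives.
Variable K : fieldType.
Local Notation bipoly := {poly {poly K}}.
Implicit Types (A B C : bipoly) (p : K * K).

Definition dX A : bipoly := map_poly (@deriv K) A.

Lemma coef_dX A j : (dX A)`_j = (A`_j)^`().
Proof. by rewrite coef_map_id0 ?deriv0. Qed.

Lemma shiftY_dX b A : shiftY b (dX A) = dX (shiftY b A).
Proof.
apply/polyP => j; rewrite coef_dX !coef_comp_poly raddf_sum /=.
have le_s : (size (dX A) <= size A)%N by apply: size_poly.
rewrite (big_ord_widen_cond _ predT (fun i => (dX A)`_i * (('X + b%:P%:P) ^+ i)`_j) le_s).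
rewrite big_mkcond /=; apply: eq_bigr => i _.
have -> : (('X + b%:P%:P : bipoly) ^+ i)`_j = ((('X + b%:P) ^+ i)`_j)%:P.
  rewrite -coef_map rmorphXn /= rmorphD /= map_polyX map_polyC //.
rewrite derivM derivC mulr0 addr0 -coef_dX; case: ltnP => // le_i.
by rewrite nth_default ?mul0r.
Qed.

Lemma shiftY_deriv b A : shiftY b A^`() = (shiftY b A)^`().
Proof. by rewrite deriv_comp derivD derivX derivC addr0 mulr1. Qed.

Lemma dvdp_linX_deriv a k (c : {poly K}) :
  linX a ^+ k %| c -> linX a ^+ k.-1 %| c^`().
Proof.
case: k => [|k]; first by rewrite expr0 !dvd1p.
case/dvdpP => h ->; rewrite derivM dvdp_add //.
  by rewrite dvdp_mull // dvdp_exp2l.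
by rewrite deriv_exp derivXsubC mul1r -mulr_natl !dvdp_mull.
Qed.

Lemma mult_ge_dX p k A : mult_ge p k A -> mult_ge p k.-1 (dX A).
Proof.
move=> kA; apply/mult_geP => j; rewrite shiftY_dX coef_dX.
have := @mult_ge_coef _ p k A j 0 (k - j) kA; rewrite addn0 leqnn mulr1 => /(_ isT).
move/dvdp_linX_deriv => dj.
apply: dvdp_trans (dvdp_mul dj (dvdpp (linX p.1 ^+ j))).
by rewrite -exprD dvdp_exp2l //; lia.
Qed.

Lemma mult_ge_deriv p k A : mult_ge p k A -> mult_ge p k.-1 A^`().
Proof.
move=> kA; apply/mult_geP => j; rewrite shiftY_deriv coef_deriv mulrnAl.
by rewrite -mulr_natl dvdp_mull // (mult_ge_coef kA) //; lia.
Qed.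

Lemma tdsize_dX A : (tdsize (dX A) <= (tdsize A).-1)%N.
Proof.
apply/tdsize_leP => j; rewrite coef_dX; have := tdsize_coef A j.
have [->|nz] := eqVneq (A`_j)^`() 0; first by rewrite mul0r size_poly0.
have nzA : A`_j != 0 by apply: contraNneq nz => ->; rewrite deriv0.
rewrite !size_mulXn // => le_j; have := lt_size_deriv nzA.
by move: le_j; move: (size _) (size _) (tdsize A); lia.
Qed.

Lemma tdsize_deriv A : (tdsize A^`() <= (tdsize A).-1)%N.
Proof.
apply/tdsize_leP => j; rewrite coef_deriv; have := tdsize_coef A j.+1.
have [->|nz] := eqVneq A`_j.+1 0; first by move=> _; rewrite mul0rn mul0r size_poly0.
have := size_scale_leq (j.+1%:R) (A`_j.+1 * 'X^j).
rewrite scaler_nat mulrnAl !size_mulXn //.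
by move: (size _) (size _) (tdsize A); lia.
Qed.

Lemma deriv_horner A (r : {poly K}) :
  A.[r]^`() = (dX A).[r] + A^`().[r] * r^`().
Proof.
have dXE B c : dX (B * 'X + c%:P) = dX B * 'X + (c^`())%:P.
  apply/polyP => -[|j]; rewrite coef_dX !coefD !coefMX !coefC /= ?add0r //.
  by rewrite !addr0 coef_dX.
elim/poly_ind: A => [|A c IHA].
  by rewrite /dX map_poly0 !deriv0 !horner0 deriv0 mul0r addr0.
rewrite dXE !derivD !derivM derivC !derivX addr0 mulr1 !hornerE derivD derivM IHA.
ring.
Qed.

End Derivatives.

Section Gauss.
Variable K : closedFieldType.
Local Notation bipoly := {poly {poly K}}.
Implicit Types (A B C : bipoly) (p : K * K).

(** Over an algebraically closed field [d] splits into linear factors; each is prime in the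
    bivariate ring, so it divides [B] or [Q] and can be removed from both sides. *)
Lemma gauss_factor (d : {poly K}) A B Q : d != 0 -> d%:P * A = B * Q ->
  exists d1 d2 B' Q', [/\ B = d1%:P * B', Q = d2%:P * Q' & A = B' * Q'].
Proof.
elim: {d}_.+1 {-2}d (ltnSn (size d)) A B Q => // n IHn d; rewrite ltnS => le_dn A B Q nzd eA.
have [/closed_rootP[a]|] := boolP (size d != 1%N); last first.
  rewrite negbK => /size_poly1P[c nzc ed].
  exists 1, d, B, (c^-1%:P%:P * Q); split; rewrite ?mul1r //.
    by rewrite mulrA -polyCM ed -polyCM divff // mul1r.
  by rewrite mulrCA -eA ed mulrA -!polyCM mulVf // mul1r.
case/factor_theorem => d' ed.
have nzd' : d' != 0 by apply: contraNneq nzd => d0; rewrite ed d0 mul0r.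
have lt_d' : (size d' < n)%N.
  by apply: leq_trans le_dn; rewrite ed size_Mmonic ?monicXsubC // size_XsubC addn2.
have nza : (linX a)%:P != 0 by rewrite polyC_eq0 linX_neq0.
have : cdvd (linX a) (B * Q).
  by rewrite -eA; apply/cdvdP; exists (d'%:P * A); rewrite mulrA -polyCM [_ * d']mulrC -ed.
rewrite cdvd_linXM => /orP[] /cdvdP[C eC].
  have [|d1 [d2 [B' [Q' [eB eQ ->]]]]] := IHn _ lt_d' A C Q nzd'.
    by apply: (mulfI nza); rewrite mulrA -polyCM [_ * d']mulrC -ed eA eC mulrA.
  by exists (linX a * d1), d2, B', Q'; split; rewrite // eC eB polyCM mulrA.
have [|d1 [d2 [B' [Q' [eB eQ ->]]]]] := IHn _ lt_d' A B C nzd'.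
  by apply: (mulfI nza); rewrite mulrA -polyCM [_ * d']mulrC -ed eA eC mulrCA.
by exists d1, (linX a * d2), B', Q'; split; rewrite // eC eQ polyCM mulrA.
Qed.

(** A [tdsize] of at most 1 means constant, so constants qualify as well; a lower bound on the
    degree is assumed where they must be excluded. *)
Definition biirred C := forall A B, C = A * B -> (tdsize A <= 1)%N \/ (tdsize B <= 1)%N.

Lemma biirred_factor_tdsize C A B : C != 0 -> biirred C -> C = A * B ->
  (1 < tdsize A)%N -> tdsize A = tdsize C.
Proof.
move=> nzC irrC eC ltA; have := nzC; rewrite eC mulf_eq0 negb_or => /andP[nzA nzB].
rewrite tdsizeM //; have := tdsize_gt0 nzB.
by case: (irrC _ _ eC); move: ltA; move: (tdsize A) (tdsize B); lia.
Qed.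

(** A zero resultant yields a common factor of positive degree in [y], up to factors in [x] alone.
    The Gauss lemma makes it a true factor of [C], hence of the full degree of [C], which is too
    large for a factor of [G]. *)
Lemma biirred_coprime C G : biirred C -> G != 0 -> (tdsize G < tdsize C)%N ->
  resultant C G != 0.
Proof.
move=> irrC nzG ltGC; rewrite resultant_eq0 -leqNgt leqNgt; apply/negP => lt1.
have nzC : C != 0 by rewrite -tdsize_eq0; move: ltGC; lia.
have := dvdp_gcdl C G; have := dvdp_gcdr C G; move: (gcdp C G) lt1 => D lt1.
move=> /Pdiv.Idomain.dvdpP[[d2 Q2] /= nzd2 eG] /Pdiv.Idomain.dvdpP[[d Q] /= nzd eC].
have size_cancel (d0 : {poly K}) B B' : (1 < size B)%N -> B = d0%:P * B' -> (1 < size B')%N.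
  move=> lt eB; have nzd0 : d0 != 0.
    by apply: contraTneq lt => d00; rewrite eB d00 mul0r size_poly0.
  by move: lt; rewrite eB mul_polyC size_scale.
rewrite -mul_polyC mulrC in eC; rewrite -mul_polyC mulrC in eG.
have {}eC : d%:P * C = D * Q by rewrite mulrC eC mulrC.
have {}eG : d2%:P * G = D * Q2 by rewrite mulrC eG mulrC.
have [d1 [_ [D' [Q' [eD _ eC']]]]] := gauss_factor nzd eC.
(* [D'] divides [G] only up to a polynomial in [x]. A second use of the Gauss lemma replaces it by
   [D2], still a factor of [C] and of positive degree in [y]. *)
have [d3 [_ [D2 [Q'' [eD' _ eG']]]]] : exists e1 e2 B' Q3,
    [/\ D' = e1%:P * B', d1%:P * Q2 = e2%:P * Q3 & G = B' * Q3].
  apply: (gauss_factor nzd2); rewrite eG eD; ring.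
have lt1' := size_cancel _ _ _ lt1 eD; have lt1'' := size_cancel _ _ _ lt1' eD'.
have : tdsize D2 = tdsize C.
  apply: (@biirred_factor_tdsize _ _ (d3%:P * Q')) => //.
    by rewrite eC' eD'; ring.
  exact: leq_trans lt1'' (size_le_tdsize _).
have := nzG; rewrite eG' mulf_eq0 negb_or => /andP[nzD2 nzQ].
move: ltGC; rewrite eG' tdsizeM //; have := tdsize_gt0 nzQ.
by move: (tdsize _) (tdsize _) (tdsize _); lia.
Qed.

End Gauss.

(** * Irreducible curves of degree at least two *)

(** A root of [p - 1] is not a root of [p]. *)
Lemma poly_nonroot (K : closedFieldType) (p : {poly K}) : p != 0 -> exists x, p.[x] != 0.
Proof.
move=> nzp; have [/size_poly1P[c nzc ->]|sp] := boolP (size p == 1)%N.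
  by exists 0; rewrite hornerC.
have /closed_rootP[x] : size (p - 1) != 1%N.
  rewrite size_polyDl // size_polyN size_poly1.
  by move: sp; have := size_poly_gt0 p; rewrite nzp; lia.
by rewrite rootE hornerD hornerN hornerC subr_eq0 => /eqP e; exists x; rewrite e oner_eq0.
Qed.

Section Irreducible.
Variable K : closedFieldType.
Local Notation bipoly := {poly {poly K}}.
Implicit Types (A B C : bipoly) (p : K * K).

Lemma tdsize_polyC (d : {poly K}) : tdsize d%:P = size d.
Proof.
apply/eqP; rewrite eqn_leq; apply/andP; split; last first.
  by have := tdsize_coef d%:P 0; rewrite coefC mulr1.
apply/tdsize_leP => -[|j]; rewrite coefC ?mulr1 //=.
by rewrite mul0r size_poly0.
Qed.

Lemma tdsize_XsubC (r : {poly K}) : (size r <= 2)%N -> tdsize ('X - r%:P) = 2%N.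
Proof.
move=> sr; apply/eqP; rewrite eqn_leq; have := size_le_tdsize ('X - r%:P).
rewrite size_XsubC => ->; rewrite andbT.
apply/tdsize_leP => -[|[|j]]; rewrite coefB coefX coefC.
- by rewrite /= sub0r mulr1 size_polyN.
- by rewrite /= subr0 mul1r size_polyXn.
by rewrite /= subr0 mul0r size_poly0.
Qed.

Variable C : bipoly.
Hypotheses (irrC : biirred C) (degC : (2 < tdsize C)%N).

Lemma biirred_neq0 : C != 0.
Proof. by rewrite -tdsize_eq0; move: degC; lia. Qed.

Lemma biirred_factor_neq2 A B : C = A * B -> tdsize A <> 2%N.
Proof.
move=> eC sA; have := biirred_factor_tdsize biirred_neq0 irrC eC.
by rewrite sA => /(_ isT) e; move: degC; rewrite -e.
Qed.

Lemma biirred_ncdvd a : ~~ cdvd (linX a) C.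
Proof.
apply/negP => /cdvdP[B eC]; apply: (biirred_factor_neq2 eC).
by rewrite tdsize_polyC size_XsubC.
Qed.

Lemma biirred_nroot (r : {poly K}) : (size r <= 2)%N -> C.[r] != 0.
Proof.
move=> sr; apply/negP => /factor_theorem[B eC]; rewrite mulrC in eC.
exact: biirred_factor_neq2 eC (tdsize_XsubC sr).
Qed.

Lemma biirred_size : (1 < size C)%N.
Proof.
rewrite ltnNge; apply/negP => /size1_polyC eC.
have /closed_rootP[a ra] : size C`_0 != 1%N.
  by rewrite -tdsize_polyC -eC; move: degC; lia.
have /negP[] := biirred_ncdvd a; apply/cdvdP.
by case/factor_theorem: ra => q eq; exists q%:P; rewrite -polyCM mulrC -eq.
Qed.

(** Otherwise all coefficients of [C] in powers of [y - p.2] would be divisible by [linX p.1], and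
    [C] would contain a vertical line. This supplies the bound on [m] in [bezout_multiplicities]. *)
Lemma biirred_mult_le p m : mult_ge p m C -> (m <= (size C).-1)%N.
Proof.
move=> mC; rewrite leqNgt; apply/negP => ltm.
have /negP[] := biirred_ncdvd p.1; apply/cdvdP.
have /cdvdP[B eB] : cdvd (linX p.1) (shiftY p.2 C).
  apply/(all_nthP 0) => j; rewrite size_shiftY => ltj.
  have := @mult_ge_coef _ p m C j 0 1 mC; rewrite mulr1; apply.
  by move: ltj ltm; move: (size C); lia.
exists (shiftY (- p.2) B).
rewrite -[LHS]comp_polyXr -[in LHS](_ : 'X + p.2%:P%:P \Po ('X + (- p.2)%:P%:P) = 'X).
  by rewrite comp_polyA -/(shiftY p.2 C) eB rmorphM /= comp_polyC.
by rewrite comp_polyD comp_polyX comp_polyC -addrA -!polyCD addNr polyC0 addr0.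
Qed.

Hypothesis char0 : [pchar K] =i pred0.

Lemma polyMn_eq0_char0 (c : {poly K}) n : (c *+ n == 0) = (n == 0)%N || (c == 0).
Proof.
rewrite -mulr_natl -polyC_natr mulf_eq0 polyC_eq0.
by have /pcharf0P -> := char0.
Qed.

Lemma deriv_eq0_char0 (c : {poly K}) : c^`() = 0 -> c = (c`_0)%:P.
Proof.
move=> c0; apply/polyP => -[|j]; rewrite coefC //=.
have := congr1 (fun q : {poly K} => q`_j) c0; rewrite coef_deriv coef0 -mulr_natl => /eqP.
by rewrite mulf_eq0; have /pcharf0P -> := char0; move/eqP.
Qed.



Lemma horner_horner A (r : {poly K}) x :
  A.[r].[x] = (map_poly (horner_eval x) A).[r.[x]].
Proof. by rewrite -[LHS]horner_evalE -horner_map. Qed.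

(** In characteristic zero a vanishing derivative would make the restriction of [C] to the line
    [y = r(x)] constant, hence zero because of the root [x], and the line would divide [C]. *)
Lemma biirred_horner_deriv (r : {poly K}) x : (size r <= 2)%N ->
  C.[r].[x] = 0 -> (dX C).[r] + C^`().[r] * r^`() != 0.
Proof.
move=> sr rx; apply/eqP; rewrite -deriv_horner => /deriv_eq0_char0 e.
have e0 : C.[r].[x] = C.[r]`_0 by rewrite {1}e hornerC.
by have /eqP[] := biirred_nroot sr; rewrite e -e0 rx polyC0.
Qed.

(* The curve [G] is a partial derivative of [C] along a direction tangent to
   [C] at [P]; it vanishes only if [C] contains a line through [P]. *)
Lemma polar_exists (P : K * K) : mult_ge P 1 C ->
  exists G, [/\ G != 0, (tdsize G <= (tdsize C).-1)%N,
    forall p m, mult_ge p m C -> mult_ge p m.-1 G & mult_ge P 1 G].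
Proof.
rewrite mult_ge1 => /eqP CP; set b := P.2 in CP; set a := P.1 in CP.
have [dXP|dXP] := eqVneq ((dX C).[b%:P].[a]) 0.
  exists (dX C); split.
  - apply: contraTneq isT => dX0.
    have sb : (size (b%:P : {poly K}) <= 2)%N by rewrite (leq_trans (size_polyC_leq1 _)).
    have /eqP[] := biirred_horner_deriv sb CP.
    by rewrite dX0 horner0 derivC mulr0 addr0.
  - exact: tdsize_dX.
  - by move=> p m; apply: mult_ge_dX.
  by rewrite mult_ge1 dXP.
(* This [l] makes the derivative of [C] in the direction [(l, 1)] vanish at [P]. *)
pose l := - (C^`().[b%:P].[a]) / (dX C).[b%:P].[a].
exists (C^`() + l%:P%:P * dX C); split.
- apply/eqP => G0; have [l0|nzl] := eqVneq l 0.
    have := congr1 (fun A : bipoly => A`_(size C).-2) G0.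
    rewrite l0 mul0r addr0 coef_deriv coef0 => /eqP; rewrite polyMn_eq0_char0 /=.
    rewrite prednK; last by have := biirred_size; case: (size C) => [|[]].
    by rewrite -lead_coefE lead_coef_eq0 (negPf biirred_neq0).
  (* The line through [P] in the direction [(l, 1)]: along it the derivative of [C] is [l^-1] times
     the restriction of [G]. *)
  pose r := l^-1 *: ('X - a%:P) + b%:P.
  have ra : r.[a] = b by rewrite /r !hornerE subrr mulr0 add0r.
  have sr : (size r <= 2)%N.
    rewrite (leq_trans (size_polyD _ _)) // geq_max.
    rewrite (leq_trans (size_scale_leq _ _)) ?size_XsubC //=.
    by rewrite (leq_trans (size_polyC_leq1 _)).
  have Cra : C.[r].[a] = 0 by rewrite horner_horner ra -CP horner_horner hornerC.
  have /eqP[] := biirred_horner_deriv sr Cra.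
  rewrite derivD derivZ derivXsubC derivC addr0 -mul_polyC mulr1.
  have := congr1 (fun A : bipoly => (l^-1)%:P * A.[r]) G0.
  rewrite horner0 mulr0 hornerD hornerCM mulrDr mulrA -polyCM mulVf // mul1r.
  by rewrite mulrC addrC.
- apply: tdsizeD; first exact: tdsize_deriv.
  have [->|nz] := eqVneq (l%:P%:P * dX C) 0; first by rewrite tdsize0.
  move: (nz); rewrite mulf_eq0 negb_or => /andP[nzl nzdX].
  rewrite tdsizeM // tdsize_polyC.
  have := size_polyC_leq1 l; have := tdsize_dX C.
  by move: (size _) (tdsize _) (tdsize _); lia.
- move=> p m mC; apply: mult_geD; first exact: mult_ge_deriv.
  exact/mult_ge_mull/mult_ge_dX.
by rewrite mult_ge1 hornerD hornerCM hornerD hornerM hornerC divfK // subrr.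
Qed.

(** Where the leading coefficient in [y] does not vanish, the vertical line still meets [C].
    Avoiding the abscissas in [s] keeps Bezout applicable with the new point added. *)
Lemma point_exists (s : seq K) : exists2 P : K * K, P.1 \notin s & mult_ge P 1 C.
Proof.
have nzl : lead_coef C * \prod_(a <- s) ('X - a%:P) != 0.
  rewrite mulf_neq0 ?lead_coef_eq0 ?biirred_neq0 //.
  by rewrite monic_neq0 // monic_prod_XsubC.
have [x] := poly_nonroot nzl; rewrite hornerM mulf_eq0 negb_or => /andP[nzx].
rewrite -rootE root_prod_XsubC => xs.
have /closed_rootP[y ry] : size (map_poly (horner_eval x) C) != 1%N.
  by rewrite size_map_poly_id0 // gtn_eqF // biirred_size.
by exists (x, y); rewrite // mult_ge1 /= horner_horner hornerC.
Qed.

(* Stands in for the adjoint curves of [C]: the degree drops by two, the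
   multiplicities only by one. *)
Lemma adjoint_exists (s : seq (K * K)) (m : K * K -> nat) : uniq (map fst s) ->
  (forall p, mult_ge p (m p) C) ->
  exists H, [/\ H != 0, (tdsize H <= (tdsize C).-2)%N &
    {in s, forall p, mult_ge p (m p).-1 H}].
Proof.
move=> us mC; have [P Ps PC] := point_exists (map fst s).
have [G [nzG sG mG PG]] := polar_exists PC.
have [c cE] : exists c, tdsize C = c.+3 by exists (tdsize C - 3)%N; move: degC; lia.
have nzR : resultant C G != 0.
  by apply: biirred_coprime => //; move: sG; rewrite cE; lia.
(* The extra point [P] contributes 1 to the Bezout sum, which makes the inequality for the points of
   [s] strict, as the count of conditions requires. *)
pose m' p := if p == P then 1%N else m p.
pose n' p := if p == P then 1%N else (m p).-1.
have sne p : p \in s -> (p == P) = false.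
  by move=> ps; apply: contraNF Ps => /eqP <-; apply: map_f.
have := @bezout_multiplicities K c.+2 c.+1 C G (P :: s) m' n'.
rewrite cE leqnn /= Ps us; rewrite cE /= in sG => /(_ isT sG nzR isT) bez.
have {}bez : (\sum_(p <- P :: s) m' p * n' p <= c.+2 * c.+1)%N.
  apply: bez => p; rewrite /m' /n'; case: eqP => [-> _|_ _] //.
  - by have := biirred_size; case: (size C) => [|[]].
  - exact: biirred_mult_le (mC p).
  by apply: mG.
apply: interpolation_exists.
move: bez; rewrite big_cons /m' /n' eqxx /=; rewrite [X in (_ + X)%N]big_seq.
under eq_bigr => p ps do rewrite sne //.
rewrite -big_seq mulnC => bez; apply: leq_trans bez; rewrite mul1n add1n ltnS.
by apply: leq_sum => p _; case: (m p) => [|k] //=; rewrite mulnC.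
Qed.

End Irreducible.

(** * Line arrangements in the affine plane *)

(** Used at a point lying on [n] of the other lines, with [b] and [b'] telling whether two chosen
    lines pass through it. *)
Lemma two_marked (b b' : bool) (n k : nat) : (n < k.-1)%N -> (k <= b + (b' + n))%N ->
  [/\ b, b' & (b + (b' + n) <= k)%N].
Proof. by case: b; case: b' => /= ltn lek; split=> //; lia. Qed.

Lemma sub_count_in (T : eqType) (P Q : pred T) (r : seq T) :
  {in r, forall x, P x -> Q x} -> (count P r <= count Q r)%N.
Proof.
elim: r => //= x r IHr PQ; apply: leq_add; last first.
  by apply: IHr => y yr; apply: PQ; rewrite inE yr orbT.
by have := PQ x (mem_head _ _); case: (P x) (Q x) => [] [] // /(_ isT).
Qed.

Section AffineArrangement.
Variable K : closedFieldType.
Hypothesis char0 : [pchar K] =i pred0.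
Local Notation bipoly := {poly {poly K}}.
Implicit Types (A B C g h l : bipoly) (p : K * K) (ls : seq bipoly).

Lemma tdsize_le1 A : (tdsize A <= 1)%N -> A = (A`_0`_0)%:P%:P.
Proof.
move=> sA; have eA := size1_polyC (leq_trans (size_le_tdsize A) sA).
by rewrite {1}eA; congr (_%:P); apply: size1_polyC; rewrite -tdsize_polyC -eA.
Qed.

Lemma tdsize_le1_mult p A : (tdsize A <= 1)%N -> mult_ge p 1 A -> A = 0.
Proof. by move=> /tdsize_le1 ->; rewrite mult_ge1 !hornerC => /eqP ->; rewrite !polyC0. Qed.

(** Both partial derivatives are constants; a double point would make them vanish, and in
    characteristic zero [l] would be constant. *)
Lemma line_mult_lt2 p l : tdsize l = 2%N -> ~~ mult_ge p 2 l.
Proof.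
move=> sl; apply/negP => l2.
have dX0 : dX l = 0.
  apply: (@tdsize_le1_mult p); last exact: mult_ge_dX l2.
  by have := tdsize_dX l; rewrite sl.
have dY0 : l^`() = 0.
  apply: (@tdsize_le1_mult p); last exact: mult_ge_deriv l2.
  by have := tdsize_deriv l; rewrite sl.
have el : l = (l`_0)%:P.
  apply/polyP => -[|j]; rewrite coefC //=; apply/eqP.
  have := congr1 (fun A : bipoly => A`_j) dY0; rewrite coef_deriv coef0 => /eqP.
  by rewrite polyMn_eq0_char0.
have := congr1 (fun A : bipoly => A`_0) dX0; rewrite coef_dX coef0.
move/(deriv_eq0_char0 char0) => e0; move: sl; rewrite el tdsize_polyC e0.
by have := size_polyC_leq1 l`_0`_0; move=> le1 e; rewrite e in le1.
Qed.

Definition on_line p l := mult_ge p 1 l.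

Lemma mult_ge_prod_lines p ls : mult_ge p (count (on_line p) ls) (\prod_(l <- ls) l).
Proof.
elim: ls => [|l ls IHls]; first by rewrite big_nil mult_ge0.
rewrite big_cons /=; apply: mult_geM => //.
by rewrite /on_line; case: (boolP (mult_ge p 1 l)) => // _; apply: mult_ge0.
Qed.

(** Lines have multiplicity exactly 0 or 1 at [p], so they can be stripped off one at a time by
    [mult_ge_cancel]. *)
Lemma count_lines_ge p ls k (c : K) : c != 0 -> all (fun l => tdsize l == 2)%N ls ->
  mult_ge p k (c%:P%:P * \prod_(l <- ls) l) -> (k <= count (on_line p) ls)%N.
Proof.
move=> nzc; elim: ls k => [|l ls IHls] k /=.
  rewrite big_nil mulr1 leqn0; case: k => // k _ /(mult_geS (ltn0Sn k)).
  by rewrite mult_ge1 !hornerC (negPf nzc).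
case/andP=> /eqP sl sls; rewrite big_cons mulrCA => kl.
have [on_l|off_l] := boolP (on_line p l).
  have := IHls _ sls (mult_ge_cancel on_l (line_mult_lt2 p sl) kl).
  by move: (count _ _); lia.
by have := IHls _ sls (mult_ge_cancel (mult_ge0 p l) off_l kl); rewrite subn0.
Qed.

Lemma tdsize_prod_lines ls : all (fun l => tdsize l == 2)%N ls ->
  tdsize (\prod_(l <- ls) l) = (size ls).+1.
Proof.
have nz1 : tdsize (1 : bipoly) = 1%N by rewrite tdsize_polyC size_poly1.
elim: ls => [|l ls IHls] /=; first by rewrite big_nil.
case/andP=> /eqP sl /IHls sls; rewrite big_cons tdsizeM ?sl ?sls //;
  by rewrite -tdsize_eq0 ?sl ?sls.
Qed.

Definition proportional l l' := exists2 c : K, c != 0 & l' = c%:P%:P * l.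

Lemma proportional_refl l : proportional l l.
Proof. by exists 1; rewrite ?oner_eq0 ?mul1r. Qed.

Lemma on_line_proportional p l l' : proportional l l' -> on_line p l' = on_line p l.
Proof.
case=> c nzc ->; rewrite /on_line !mult_ge1 hornerCM hornerM hornerC mulf_eq0.
by rewrite (negPf nzc).
Qed.

Variables (s : seq (K * K)) (k a : nat) (f : bipoly).
Hypothesis uniq_s : uniq (map fst s).
Hypothesis k_gt0 : (0 < k)%N.
(** Since [tdsize] is the degree plus one, [minimal] concerns degrees below [a], while [f] has
    degree [a + 1]. *)
Hypothesis minimal : forall g, (tdsize g <= a)%N ->
  {in s, forall p, mult_ge p k.-1 g} -> g = 0.
Hypothesis tdsize_f : tdsize f = a.+2.
Hypothesis mult_f : {in s, forall p, mult_ge p k f}.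

(** Trading [C] for its adjoint [H] lowers the degree by two and each multiplicity by at most one,
    against [minimal]. *)
Lemma factor_tdsize_le2 C h : f = C * h -> biirred C -> (tdsize C <= 2)%N.
Proof.
move=> ef irrC; rewrite leqNgt; apply/negP => degC.
have : f != 0 by rewrite -tdsize_eq0 tdsize_f.
rewrite ef mulf_eq0 negb_or => /andP[nzC nzh].
have [m mC] := mult_exists nzC.
have mC1 p : mult_ge p (m p) C by have /andP[] := mC p.
have [H [nzH sH mH]] := adjoint_exists irrC degC char0 uniq_s mC1.
have /eqP : H * h = 0; last by rewrite mulf_eq0 (negPf nzH) (negPf nzh).
apply: minimal => [|p ps].
  have := tdsize_f; rewrite ef !tdsizeM //.
  have := tdsize_gt0 nzh; move: degC sH.
  by move: (tdsize C) (tdsize H) (tdsize h); lia.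
have /andP[_ mC2] := mC p; have := mult_f ps; rewrite ef => /(mult_ge_cancel (mC1 p) mC2) mh.
by apply: mult_geS (mult_geM (mH p ps) mh); lia.
Qed.

(** The cofactor [h] is carried through the induction so that every piece of [g] remains a factor of
    [f], where [factor_tdsize_le2] applies. *)
Lemma factor_lines g h : f = g * h -> exists (c : K) ls,
  [/\ g = c%:P%:P * \prod_(l <- ls) l & all (fun l => tdsize l == 2)%N ls].
Proof.
elim: {g}_.+1 {-2}g (ltnSn (tdsize g)) h => // n IHn g; rewrite ltnS => le_gn h ef.
have : f != 0 by rewrite -tdsize_eq0 tdsize_f.
rewrite ef mulf_eq0 negb_or => /andP[nzg nzh].
have [le1|gt1] := leqP (tdsize g) 1.
  by exists g`_0`_0, [::]; rewrite big_nil mulr1 -tdsize_le1.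
have [le2|gt2] := leqP (tdsize g) 2.
  exists 1, [:: g]; rewrite big_seq1 mul1r; split=> //=.
  by rewrite eqn_leq le2 gt1.
have [A [B [eg gtA gtB]]] : exists A B, [/\ g = A * B, (1 < tdsize A)%N & (1 < tdsize B)%N].
  apply: NNPP => nAB; move: gt2; rewrite ltnNge (factor_tdsize_le2 ef) // => A B eg.
  have [le|gtA] := leqP (tdsize A) 1; [by left | right].
  by rewrite leqNgt; apply/negP => gtB; case: nAB; exists A, B.
have := nzg; rewrite eg mulf_eq0 negb_or => /andP[nzA nzB].
have := tdsizeM nzA nzB; rewrite -eg => sAB.
have ltA : (tdsize A < n)%N.
  by move: le_gn gtB sAB; move: (tdsize A) (tdsize B) (tdsize g); lia.
have ltB : (tdsize B < n)%N.
  by move: le_gn gtA sAB; move: (tdsize A) (tdsize B) (tdsize g); lia.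
have fA : f = A * (B * h) by rewrite ef eg mulrA.
have fB : f = B * (A * h) by rewrite ef eg mulrCA mulrA.
have [c1 [l1 [eA al1]]] := IHn A ltA _ fA.
have [c2 [l2 [eB al2]]] := IHn B ltB _ fB.
exists (c1 * c2), (l1 ++ l2); rewrite all_cat al1 al2 big_cat /= eg eA eB !polyCM.
by split=> //; rewrite mulrACA.
Qed.

(** Without [l] and [l'] the product has degree [a - 1], so by [minimal] some [p] in [s] lies on
    fewer than [k - 1] of the other lines. As [p] lies on at least [k] lines in all, it is on both,
    and the total is exactly [k]. *)
Lemma lines_meet (c : K) ls l l' : f = c%:P%:P * \prod_(l <- ls) l ->
  all (fun l => tdsize l == 2)%N ls -> l \in ls -> l' \in ls -> l != l' ->
  exists p, [/\ p \in s, on_line p l, on_line p l' & (count (on_line p) ls <= k)%N].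
Proof.
move=> ef al l_in l'_in ne; have nzf : f != 0 by rewrite -tdsize_eq0 tdsize_f.
have nzc : c != 0 by apply: contraNneq nzf => c0; rewrite ef c0 !polyC0 mul0r.
have p1 := perm_to_rem l_in.
have l'_in2 : l' \in rem l ls by move: l'_in; rewrite (perm_mem p1) inE eq_sym (negPf ne).
have p2 : perm_eq ls [:: l, l' & rem l' (rem l ls)].
  by apply: perm_trans p1 _; rewrite perm_cons perm_to_rem.
set r := rem l' (rem l ls) in p2.
have al_r : all (fun l => tdsize l == 2)%N r.
  by have := al; rewrite (perm_all _ p2) /= => /and3P[].
have : ~~ all (fun p => mult_ge p k.-1 (\prod_(l <- r) l)) s.
  apply/negP => /allP mr.
  have sr : tdsize (\prod_(l <- r) l) = a.
    have : tdsize f = (size ls).+1.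
      rewrite ef tdsizeM ?tdsize_prod_lines ?tdsize_polyC ?size_polyC ?nzc //.
        by rewrite !polyC_eq0.
      by rewrite -tdsize_eq0 tdsize_prod_lines.
    by rewrite tdsize_f (perm_size p2) tdsize_prod_lines // => -[].
  have := minimal (eq_leq sr) mr; move/eqP; rewrite -tdsize_eq0.
  by rewrite tdsize_prod_lines.
case/allPn => p ps npr; exists p.
have lt_r : (count (on_line p) r < k.-1)%N.
  rewrite ltnNge; apply: contra npr => le_r; exact: mult_geS le_r (mult_ge_prod_lines _ _).
have := mult_f ps; rewrite ef => /(count_lines_ge nzc al).
have/seq.permP/(_ (on_line p)) /= -> := p2.
by case/(two_marked lt_r).
Qed.

Theorem affine_arrangement : exists ls,
  all (fun l => tdsize l == 2)%N ls /\
  ((exists2 l, l \in ls & {in s, forall p, on_line p l}) \/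
   {in s, forall p, exists l l', [/\ l \in ls, l' \in ls, on_line p l, on_line p l'
      & ~ proportional l l']} /\
   {in ls &, forall l l', ~ proportional l l' ->
      exists2 p, p \in s & on_line p l && on_line p l'}).
Proof.
have [|c [ls [ef al]]] := @factor_lines f 1; first by rewrite mulr1.
have nzf : f != 0 by rewrite -tdsize_eq0 tdsize_f.
have nzc : c != 0 by apply: contraNneq nzf => c0; rewrite ef c0 !polyC0 mul0r.
exists ls; split=> //.
have ne_of l l' : ~ proportional l l' -> l != l'.
  by move=> npar; apply/eqP => e; apply: npar; rewrite e; apply: proportional_refl.
have count_ge p : p \in s -> (k <= count (on_line p) ls)%N.
  by move=> /mult_f; rewrite ef => /count_lines_ge; apply.
case: (classic (exists2 l, l \in ls & {in s, forall p, on_line p l})) => [|ncol].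
  by left.
right; split=> [p ps|l l' l_in l'_in /ne_of ne]; last first.
  by have [p [ps pl pl' _]] := lines_meet ef al l_in l'_in ne; exists p; rewrite // pl.
apply: NNPP => nopair; have cp := count_ge p ps.
have /hasP[l l_in pl] : has (on_line p) ls by rewrite has_count (leq_trans k_gt0 cp).
have par_l l' : l' \in ls -> on_line p l' -> proportional l l'.
  by move=> l'_in pl'; apply: NNPP => npar; case: nopair; exists l, l'.
apply: ncol; exists l => // q qs.
have /hasP[l' l'_in ql'] : has (on_line q) ls.
  by rewrite has_count (leq_trans k_gt0 (count_ge q qs)).
case: (classic (proportional l l')) => [/(on_line_proportional q) <- //|npar].
have [t [ts tl tl' ct]] := lines_meet ef al l_in l'_in (ne_of _ _ npar).
have npl' : on_line p l' = false by apply/negP => /(par_l _ l'_in).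
(* The lines through [p] are all proportional to [l], so they pass through [t]; the line [l'] passes
   through [t] but not through [p]. *)
suff : (count (on_line p) ls < count (on_line t) ls)%N by rewrite ltnNge (leq_trans ct cp).
have/seq.permP p1 := perm_to_rem l'_in; rewrite !p1 /= npl' tl' ltnS.
apply: sub_count_in => l2 /mem_rem l2_in pl2.
by rewrite (on_line_proportional t (par_l _ l2_in pl2)).
Qed.

End AffineArrangement.

(** * Ideals of points and linear forms *)

Section IdealPowers.
Variables (K : fieldType) (P : coords K).
Implicit Types (f g l : {mpoly K[3]}).

Lemma in_Ipow0 f : in_Ipow P 0 f.
Proof.
exists 1%N, (fun=> f), (fun _ _ => 0); split=> [j []//|].
by rewrite big_ord1 big_ord0 mulr1.
Qed.

Lemma in_Ipow_zero k : in_Ipow P k 0.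
Proof.
exists 0%N, (fun=> 0), (fun _ _ => 0); split=> [[]//|].
by rewrite big_ord0.
Qed.

Lemma in_IpowD k f g : in_Ipow P k f -> in_Ipow P k g -> in_Ipow P k (f + g).
Proof.
case=> m1 [g1 [L1 [h1 ->]]] [m2 [g2 [L2 [h2 ->]]]].
exists (m1 + m2)%N, (fun j => match split j with inl i => g1 i | inr i => g2 i end),
  (fun j => match split j with inl i => L1 i | inr i => L2 i end); split.
  by move=> j i; case: (split j) => j'.
rewrite big_split_ord /=; congr (_ + _); apply: eq_bigr => i _.
  by rewrite -[lshift _ _]/(unsplit (inl i)) unsplitK.
by rewrite -[rshift _ _]/(unsplit (inr i)) unsplitK.
Qed.

Lemma in_IpowS k l f : lin_at P l -> in_Ipow P k f -> in_Ipow P k.+1 (l * f).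
Proof.
move=> hl [m [g [L [hL ->]]]].
exists m, g, (fun j i => if unlift ord0 i is Some i' then L j i' else l); split.
  by move=> j i; case: unliftP.
rewrite mulr_sumr; apply: eq_bigr => j _; rewrite big_ord_recl unlift_none mulrCA.
by congr (_ * (_ * _)); apply: eq_bigr => i _; rewrite liftK.
Qed.

Lemma in_Ipow_exp k t l f : lin_at P l -> in_Ipow P k f -> in_Ipow P (t + k) (l ^+ t * f).
Proof.
move=> hl hf; elim: t => [|t IHt]; first by rewrite mul1r.
by rewrite addSn exprS -mulrA; apply: in_IpowS.
Qed.

Lemma in_Ipow_le k t f : (t <= k)%N -> in_Ipow P k f -> in_Ipow P t f.
Proof.
move=> /subnK <-; elim: (k - t)%N => // n IHn [m [g [L [hL fE]]]]; apply: IHn.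
exists m, (fun j => g j * L j ord0), (fun j i => L j (lift ord0 i)); split=> //.
by rewrite fE; apply: eq_bigr => j _; rewrite big_ord_recl mulrA.
Qed.

End IdealPowers.

Lemma rmorph_mmap n (R : comNzRingType) (S T : comNzRingType) (h : {rmorphism R -> S})
    (phi : {rmorphism S -> T}) (e : 'I_n -> S) (f : {mpoly R[n]}) :
  phi (mmap h e f) = mmap (phi \o h) (phi \o e) f.
Proof.
rewrite /mmap rmorph_sum; apply: eq_bigr => m _; rewrite rmorphM rmorph_prod.
by congr (_ * _); apply: eq_bigr => i _; rewrite rmorphXn.
Qed.

Lemma mmap_homog_scale n (R S : comNzRingType) (h : R -> S) (e : 'I_n -> S) (t : S) d
    (f : {mpoly R[n]}) : f \is d.-homog ->
  mmap h (fun i => t * e i) f = t ^+ d * mmap h e f.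
Proof.
move=> /dhomogP hf; rewrite /mmap big_distrr /=; apply: eq_big_seq => m /hf <-.
rewrite mulrCA /mmap1 /= mdegE -prodrXr -big_split /=.
by congr (_ * _); apply: eq_bigr => i _; rewrite exprMn.
Qed.

Lemma ord3P (i : 'I_3) : [\/ i = 0, i = 1 | i = 2%:R].
Proof.
by case: i => [[|[|[]]] // lt]; [constructor 1 | constructor 2 | constructor 3];
  apply: val_inj.
Qed.

Section LinearForms.
Variable K : fieldType.
Implicit Types (l : {mpoly K[3]}) (P Q : coords K).

Lemma homog1E l : l \is 1.-homog -> l = \sum_(i < 3) l@_U_(i) *: 'X_i.
Proof.
move=> hl; apply/mpolyP => m; rewrite raddf_sum /=.
have [/mdeg1P[i /eqP ->]|ne] := boolP (mdeg m == 1)%N.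
  rewrite (bigD1 i) //= big1 => [|j ne]; rewrite mcoeffZ mcoeffXU.
    by rewrite eqxx mulr1 addr0.
  by rewrite (negPf ne) mulr0.
rewrite (dhomog_nemf_coeff hl ne) big1 // => i _; rewrite mcoeffZ mcoeffX.
by case: eqP => [e|_]; [rewrite -e mdeg1 in ne | rewrite mulr0].
Qed.

Lemma meval_homog1 l P : l \is 1.-homog -> l.@[P] = \sum_(i < 3) l@_U_(i) * P i.
Proof.
by move=> /homog1E {1}->; rewrite raddf_sum; apply: eq_bigr => i _ /=; rewrite mevalZ mevalXU.
Qed.

Lemma collinear_vectors (v w : 'I_3 -> K) : (exists i, v i != 0) -> (exists i, w i != 0) ->
  (forall i j, v i * w j = v j * w i) -> exists2 c, c != 0 & forall i, v i = c * w i.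
Proof.
move=> [i0 vi0] [j0 wj0] vw; exists (v j0 / w j0); last first.
  by move=> i; rewrite mulrAC -vw mulfK.
rewrite mulf_neq0 ?invr_eq0 //; apply: contraNneq vi0 => v0.
by have := vw i0 j0; rewrite v0 mul0r => /eqP; rewrite mulf_eq0 (negPf wj0) orbF.
Qed.

Lemma homog1_neq0 l : l != 0 -> l \is 1.-homog -> exists i, l@_U_(i) != 0.
Proof.
move=> nzl hl; apply/existsP; apply: contraNT nzl => /existsPn l0.
rewrite (homog1E hl) big1 // => i _; have := l0 i; rewrite negbK => /eqP ->.
by rewrite scale0r.
Qed.

(** The coefficient vectors of both lines are orthogonal to [P] and [Q]. If the cross product [w] of
    [P] and [Q] is nonzero, both are multiples of it and the lines agree; if it is zero, [P] and [Q]
    are proportional. *)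
Lemma lines_meet_once l l' P Q : is_line l -> is_line l' -> ~ same_line l l' ->
  nonzero_pt P -> nonzero_pt Q -> l.@[P] = 0 -> l'.@[P] = 0 ->
  l.@[Q] = 0 -> l'.@[Q] = 0 -> same_pt P Q.
Proof.
move=> [nzl hl] [nzl' hl'] nsame nzP nzQ.
rewrite !meval_homog1 // !big_ord_recl !big_ord0 !addr0 => lP l'P lQ l'Q.
pose w (i : 'I_3) := P (i + 1) * Q (i + 2%:R) - P (i + 2%:R) * Q (i + 1).
(* Each case is a component of the identity [a x (P x Q) = (a.Q) P - (a.P) Q], with indices taken
   modulo 3. *)
have perp (a : 'I_3 -> K) :
    a 0 * P 0 + (a 1 * P 1 + a 2%:R * P 2%:R) = 0 ->
    a 0 * Q 0 + (a 1 * Q 1 + a 2%:R * Q 2%:R) = 0 ->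
    forall i j, a i * w j = a j * w i.
  move=> aP aQ.
  have e01 : a 0 * w 1 = a 1 * w 0.
    apply/eqP; rewrite -subr_eq0; apply/eqP.
    transitivity (P 2%:R * (a 0 * Q 0 + (a 1 * Q 1 + a 2%:R * Q 2%:R)) -
                  Q 2%:R * (a 0 * P 0 + (a 1 * P 1 + a 2%:R * P 2%:R))).
      rewrite /w; have -> : 1 + 1 = 2%:R :> 'I_3 by apply: val_inj.
      have -> : 1 + 2%:R = 0 :> 'I_3 by apply: val_inj.
      by rewrite !add0r; ring.
    by rewrite aP aQ !mulr0 subrr.
  have e12 : a 1 * w 2%:R = a 2%:R * w 1.
    apply/eqP; rewrite -subr_eq0; apply/eqP.
    transitivity (P 0 * (a 0 * Q 0 + (a 1 * Q 1 + a 2%:R * Q 2%:R)) -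
                  Q 0 * (a 0 * P 0 + (a 1 * P 1 + a 2%:R * P 2%:R))).
      rewrite /w; have -> : 1 + 1 = 2%:R :> 'I_3 by apply: val_inj.
      have -> : 1 + 2%:R = 0 :> 'I_3 by apply: val_inj.
      have -> : 2%:R + 1 = 0 :> 'I_3 by apply: val_inj.
      have -> : 2%:R + 2%:R = 1 :> 'I_3 by apply: val_inj.
      by ring.
    by rewrite aP aQ !mulr0 subrr.
  have e20 : a 2%:R * w 0 = a 0 * w 2%:R.
    apply/eqP; rewrite -subr_eq0; apply/eqP.
    transitivity (P 1 * (a 0 * Q 0 + (a 1 * Q 1 + a 2%:R * Q 2%:R)) -
                  Q 1 * (a 0 * P 0 + (a 1 * P 1 + a 2%:R * P 2%:R))).
      rewrite /w !add0r.
      have -> : 2%:R + 1 = 0 :> 'I_3 by apply: val_inj.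
      have -> : 2%:R + 2%:R = 1 :> 'I_3 by apply: val_inj.
      by ring.
    by rewrite aP aQ !mulr0 subrr.
  by move=> i j; case: (ord3P i) => ->; case: (ord3P j) => ->.
have lift1 : lift ord0 ord0 = 1 :> 'I_3 by apply: val_inj.
have lift2 : lift ord0 (lift ord0 ord0) = 2%:R :> 'I_3 by apply: val_inj.
rewrite -[ord0]/(0 : 'I_3) ?lift1 ?lift2 in lP l'P lQ l'Q.
have [/existsP nzw|/existsPn w0] := boolP [exists i, w i != 0].
  have [c nzc lc] := collinear_vectors (homog1_neq0 nzl hl) nzw (perp (fun i => l@_U_(i)) lP lQ).
  have [c' nzc' lc'] := collinear_vectors (homog1_neq0 nzl' hl') nzw (perp (fun i => l'@_U_(i)) l'P l'Q).
  case: nsame; exists (c' / c); split; first by rewrite mulf_neq0 ?invr_eq0.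
  rewrite (homog1E hl) (homog1E hl') scaler_sumr; apply: eq_bigr => i _.
  by rewrite lc lc' scalerA mulrA divfK.
have {}w0 i : w i = 0 by apply/eqP; have := w0 i; rewrite negbK.
have [c nzc Qc] : exists2 c, c != 0 & forall i, Q i = c * P i; last by exists c.
apply: collinear_vectors => //.
have := w0 0; have := w0 1; have := w0 2%:R; rewrite /w !add0r.
have -> : 1 + 1 = 2%:R :> 'I_3 by apply: val_inj.
have -> : 1 + 2%:R = 0 :> 'I_3 by apply: val_inj.
have -> : 2%:R + 1 = 0 :> 'I_3 by apply: val_inj.
have -> : 2%:R + 2%:R = 1 :> 'I_3 by apply: val_inj.
move=> /subr0_eq e2 /subr0_eq e1 /subr0_eq e0 i j.
case: (ord3P i) => ->; case: (ord3P j) => -> //; rewrite ![Q _ * _]mulrC //.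
Qed.

End LinearForms.

(** * Dehomogenization *)

Section TdsizeExtra.
Variable K : closedFieldType.
Local Notation bipoly := {poly {poly K}}.
Implicit Types (A B g : bipoly).

Lemma tdsizeM_le A B m n : (tdsize A <= m.+1)%N -> (tdsize B <= n.+1)%N ->
  (tdsize (A * B)%R <= (m + n).+1)%N.
Proof.
move=> sA sB; have [->|nzA] := eqVneq A 0; first by rewrite mul0r tdsize0.
have [->|nzB] := eqVneq B 0; first by rewrite mulr0 tdsize0.
by rewrite tdsizeM //; move: sA sB; move: (tdsize A) (tdsize B); lia.
Qed.

Lemma tdsizeX_le A n : (tdsize A <= 2)%N -> (tdsize (A ^+ n)%R <= n.+1)%N.
Proof.
move=> sA; elim: n => [|n IHn]; first by rewrite tdsize_polyC size_poly1.
by rewrite exprS; apply: (@tdsizeM_le _ _ 1 n).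
Qed.

Lemma tdsize_sum_le (I : Type) (r : seq I) (P : pred I) (F : I -> bipoly) n :
  (forall i, P i -> tdsize (F i) <= n)%N -> (tdsize (\sum_(i <- r | P i) F i)%R <= n)%N.
Proof.
move=> sF; apply: (big_ind (fun A => tdsize A <= n)%N) => [|A B|].
- by rewrite tdsize0.
- exact: tdsizeD.
exact: sF.
Qed.

Lemma tdsize_shiftY b g : (tdsize (shiftY b g) <= tdsize g)%N.
Proof.
rewrite /shiftY comp_polyE; apply: tdsize_sum_le => i _.
rewrite -mul_polyC; have [->|nz] := eqVneq g`_i 0; first by rewrite mul0r tdsize0.
have := tdsize_coef g i; rewrite size_mulXn // => le_i; apply: leq_trans le_i.
have sX : (tdsize ('X + b%:P%:P : bipoly) <= 2)%N.
  have -> : 'X + b%:P%:P = 'X - (- b)%:P%:P :> bipoly by rewrite !polyCN opprK.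
  by rewrite tdsize_XsubC // (leq_trans (size_polyC_leq1 _)).
have sg : (0 < size (g`_i)%R)%N by rewrite size_poly_gt0.
rewrite -(prednK sg) addnS addnC; apply: tdsizeM_le; last exact: tdsizeX_le.
by rewrite tdsize_polyC prednK.
Qed.

End TdsizeExtra.

Section Dehomogenization.
Variable K : closedFieldType.
Local Notation bipoly := {poly {poly K}}.
Local Notation form := {mpoly K[3]}.

(* Coordinates [al, be, u] of the plane, with [u] the line at infinity; [px],
   [py], [pz] express the standard coordinates in terms of them. *)
Variables (al be u : form) (px py pz : 'I_3 -> K).
Hypotheses (al_hom : al \is 1.-homog) (be_hom : be \is 1.-homog) (u_hom : u \is 1.-homog).
Hypothesis XE : forall i, 'X_i = px i *: al + py i *: be + pz i *: u.

Definition constXY : {rmorphism K -> bipoly} := (@polyC {poly K}) \o (@polyC K).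

Definition affX (i : 'I_3) : bipoly := (px i *: 'X)%:P + (py i)%:P *: 'X + (pz i)%:P%:P.

Definition dehom : {rmorphism form -> bipoly} := mmap constXY affX.

Hypotheses (dehom_al : dehom al = 'X%:P) (dehom_be : dehom be = 'X) (dehom_u : dehom u = 1).

Lemma dehomZ c (f : form) : dehom (c *: f) = c%:P%:P * dehom f.
Proof. exact: mmapZ. Qed.

Lemma u_neq0 : u != 0.
Proof. by apply/eqP => u0; have /eqP := dehom_u; rewrite u0 rmorph0 eq_sym oner_eq0. Qed.

Lemma tdsize_affX i : (tdsize (affX i) <= 2)%N.
Proof.
rewrite /affX; apply: tdsizeD; first apply: tdsizeD.
- rewrite tdsize_polyC (leq_trans (size_scale_leq _ _)) // size_polyX //.
- rewrite -mul_polyC; apply: (@tdsizeM_le _ _ _ 0 1).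
    by rewrite tdsize_polyC size_polyC_leq1.
  by rewrite -['X]subr0 -polyC0 tdsize_XsubC // size_poly0.
by rewrite tdsize_polyC (leq_trans (size_polyC_leq1 _)).
Qed.

Lemma tdsize_dehom n f : f \is n.-homog -> (tdsize (dehom f) <= n.+1)%N.
Proof.
move=> /dhomogP hf; rewrite [dehom f]/(mmap _ _ _) /mmap big_seq.
apply: tdsize_sum_le => m /hf dm; have {dm} <- : mdeg m = n := dm.
apply: (@tdsizeM_le _ _ _ 0 (mdeg m)).
  by rewrite tdsize_polyC size_polyC_leq1.
rewrite /mmap1 mdegE; apply: (big_ind2 (fun (A : bipoly) d => tdsize A <= d.+1)%N).
- by rewrite tdsize_polyC size_poly1.
- by move=> A d B e; apply: tdsizeM_le.
by move=> i _; apply/tdsizeX_le/tdsize_affX.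
Qed.

Local Notation frac := {fraction form}.
(** Substituting [al / u] and [be / u] for the affine variables recovers a form of degree [n]
    divided by [u ^+ n]. Hence [dehom] is injective on forms of a fixed degree. *)
Definition fracC : {rmorphism K -> frac} := (@tofrac form) \o (@mpolyC 3 K).
Definition evalX : {rmorphism {poly K} -> frac} :=
  horner_eval (tofrac al / tofrac u) \o map_poly fracC.
Definition evalXY : {rmorphism bipoly -> frac} :=
  horner_eval (tofrac be / tofrac u) \o map_poly evalX.

Lemma evalX_C c : evalX c%:P = tofrac c%:MP.
Proof. by rewrite /evalX /= map_polyC /= horner_evalE hornerC. Qed.

Lemma evalXY_C c : evalXY c%:P = evalX c.
Proof. by rewrite /evalXY /= map_polyC /= horner_evalE hornerC. Qed.

Lemma evalXY_affX i : evalXY (affX i) = (tofrac u)^-1 * tofrac 'X_i.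
Proof.
have nzu : tofrac u != 0 by rewrite tofrac_eq0 u_neq0.
rewrite /affX !rmorphD -!mul_polyC !evalXY_C !rmorphM !evalXY_C !evalX_C.
have -> : evalX 'X = tofrac al / tofrac u.
  by rewrite /evalX /= map_polyX horner_evalE hornerX.
have -> : evalXY 'X = tofrac be / tofrac u.
  by rewrite /evalXY /= map_polyX horner_evalE hornerX.
rewrite XE -!mul_mpolyC !rmorphD !rmorphM /= !mulrDr; congr (_ + _ + _); first by ring.
  by ring.
by rewrite mulrCA mulVf ?mulr1.
Qed.

Lemma evalXY_dehom n f : f \is n.-homog ->
  evalXY (dehom f) = (tofrac u)^-1 ^+ n * tofrac f.
Proof.
move=> hf; rewrite rmorph_mmap.
transitivity (mmap (evalXY \o constXY) (fun i => (tofrac u)^-1 * tofrac 'X_i) f).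
  rewrite /mmap; apply: eq_bigr => m _; congr (_ * _); apply: eq_bigr => i _.
  exact: (congr1 (fun z => z ^+ m i) (evalXY_affX i)).
rewrite (mmap_homog_scale _ _ _ hf); congr (_ * _).
rewrite {2}(mpolyE f) rmorph_sum /mmap; apply: eq_bigr => m _.
rewrite -mul_mpolyC rmorphM -[(_ \o _) _]/(evalXY (f@_m)%:P%:P) evalXY_C evalX_C.
congr (_ * _).
by rewrite mpolyXE_id rmorph_prod; apply: eq_bigr => i _; rewrite rmorphXn.
Qed.

Lemma dehom_inj n f g : f \is n.-homog -> g \is n.-homog -> dehom f = dehom g -> f = g.
Proof.
move=> hf hg efg; have := congr1 evalXY efg.
rewrite (evalXY_dehom hf) (evalXY_dehom hg) => /mulfI.
rewrite expf_neq0 ?invr_eq0 ?tofrac_eq0 ?u_neq0 // => /(_ isT) /eqP.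
by rewrite tofrac_eq => /eqP.
Qed.

Lemma dehom_neq0 n f : f \is n.-homog -> f != 0 -> dehom f != 0.
Proof.
move=> hf; apply: contra => /eqP f0; apply/eqP; apply: (dehom_inj hf (dhomog0 _ _ _)).
by rewrite f0 rmorph0.
Qed.

Lemma homog1X k (l : form) : l \is 1.-homog -> l ^+ k \is k.-homog.
Proof. by move=> /(@dhomogMn _ _ _ _ _ k); rewrite mul1n. Qed.

Lemma monomial_homog i j n : (i + j <= n)%N ->
  al ^+ i * be ^+ j * u ^+ (n - (i + j)) \is n.-homog.
Proof. by move=> le_n; rewrite -{2}(subnKC le_n) !dhomogM ?homog1X. Qed.

(** The monomial [x^i y^j] lifts to [al ^+ i * be ^+ j], padded with a power of [u] up to degree
    [n]. *)
Lemma hom_exists n g : (tdsize g <= n.+1)%N -> exists2 f, f \is n.-homog & dehom f = g.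
Proof.
move=> sg; pose Q (h : bipoly) := exists2 f, f \is n.-homog & dehom f = h.
have QD (I : finType) (F : I -> bipoly) : (forall i, Q (F i)) -> Q (\sum_i F i).
  move=> QF; apply: (big_ind Q) => [|A B [f1 h1 <-] [f2 h2 <-]|i _].
  - by exists 0; rewrite ?rmorph0 ?dhomog0.
  - by exists (f1 + f2); rewrite ?rmorphD ?dhomogD.
  exact: QF.
rewrite -[g]coefK poly_def; apply: (QD _ _) => j; rewrite -mul_polyC -[g`_j]coefK poly_def.
rewrite rmorph_sum mulr_suml; apply: QD => i.
have le_ij : (i + j <= n)%N.
  have := tdsize_coef g j; rewrite size_mulXn; last first.
    by rewrite -size_poly_gt0 (leq_ltn_trans (leq0n i) (ltn_ord i)).
  move=> sz; rewrite -ltnS (leq_trans _ sg) // (leq_trans _ sz) //.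
  by rewrite addnC -addnS leq_add2l.
exists (g`_j`_i *: (al ^+ i * be ^+ j * u ^+ (n - (i + j)))).
  by rewrite dhomogZ // monomial_homog.
rewrite dehomZ !rmorphM !rmorphXn dehom_al dehom_be dehom_u expr1n mulr1.
by rewrite -mul_polyC !rmorphM /= rmorphXn mulrA.
Qed.

Section Point.
Variable P : coords K.
Hypothesis uP : u.@[P] != 0.

Definition affpt : K * K := (al.@[P] / u.@[P], be.@[P] / u.@[P]).

Lemma horner_dehom n f : f \is n.-homog ->
  (dehom f).[affpt.2%:P].[affpt.1] = (u.@[P])^-1 ^+ n * f.@[P].
Proof.
move=> hf; pose ev : {rmorphism bipoly -> K} :=
  horner_eval affpt.1 \o horner_eval affpt.2%:P.
rewrite -[LHS]/(ev (dehom f)) rmorph_mmap.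
rewrite -(mmap_homog_scale _ _ _ hf) /mmap; apply: eq_bigr => m _.
congr (_ * _); first by rewrite /= !horner_evalE !hornerC.
apply: eq_bigr => i _; congr (_ ^+ _).
rewrite /= /affX !horner_evalE !hornerE /=.
have := mevalXU P i; rewrite XE !mevalD !mevalZ => <-.
by rewrite !mulrDr; congr (_ + _ + _); [ring | ring | rewrite mulrCA mulVf ?mulr1].
Qed.

Lemma mult_ge_dehom_lin l : l \is 1.-homog -> mult_ge affpt 1 (dehom l) = (l.@[P] == 0).
Proof.
move=> hl; rewrite mult_ge1 (horner_dehom hl) mulf_eq0 expf_eq0 invr_eq0.
by rewrite (negPf uP).
Qed.

Lemma mult_ge_dehom k f : in_Ipow P k f -> mult_ge affpt k (dehom f).
Proof.
case=> m [g [L [hL ->]]]; rewrite rmorph_sum.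
apply: (big_ind (mult_ge affpt k)) => [|A B|j _].
- by apply/mult_geP => j; rewrite /shiftY comp_poly0 coef0 mul0r dvdp0.
- exact: mult_geD.
rewrite rmorphM; apply: mult_ge_mull; rewrite rmorph_prod.
have : mult_ge affpt (\sum_(i < k) 1) (\prod_(i < k) dehom (L j i)).
  apply: (big_ind2 (fun d A => mult_ge affpt d A)) => [|d A e B|i _].
  - exact: mult_ge0.
  - exact: mult_geM.
  by have [hl /eqP Lp] := hL j i; rewrite mult_ge_dehom_lin.
by rewrite sum1_card card_ord.
Qed.

(** In the expansion of [dehom f] in powers of [y - p.2], the coefficient of the power [j] is
    divisible by the power [k - j] of [linX p.1]. Each term lifts to a form of degree [n] with at
    least [k] linear factors vanishing at [P], and by injectivity the lifts add up to [f]. *)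
Lemma in_Ipow_dehom n k f : f \is n.-homog -> mult_ge affpt k (dehom f) -> in_Ipow P k f.
Proof.
set p := affpt => hf kf; set g := dehom f in kf.
have sg : (tdsize g <= n.+1)%N := tdsize_dehom hf.
pose Q (h : bipoly) := exists f', [/\ f' \is n.-homog, dehom f' = h & in_Ipow P k f'].
suff [f' [hf' /(dehom_inj hf' hf) <-]] : Q g by [].
have -> : g = \sum_(j < size (shiftY p.2 g))
    ((shiftY p.2 g)`_j)%:P * ('X - p.2%:P%:P) ^+ j.
  rewrite -[LHS]comp_polyXr -[in LHS](_ : 'X + p.2%:P%:P \Po ('X - p.2%:P%:P) = 'X).
    rewrite comp_polyA comp_polyE; apply: eq_bigr => j _; by rewrite -mul_polyC.
  by rewrite comp_polyD comp_polyX comp_polyC subrK.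
apply: (big_ind Q) => [|A B [f1 [h1 <- I1]] [f2 [h2 <- I2]]|j _].
- by exists 0; rewrite rmorph0 dhomog0; split=> //; apply: in_Ipow_zero.
- by exists (f1 + f2); rewrite rmorphD dhomogD //; split=> //; apply: in_IpowD.
set c := (shiftY p.2 g)`_j.
have [->|nzc] := eqVneq c 0.
  by rewrite mul0r; exists 0; rewrite rmorph0 dhomog0; split=> //; apply: in_Ipow_zero.
have := @mult_ge_coef _ p k g j 0 (k - j) kf; rewrite addn0 leqnn mulr1 => /(_ isT).
rewrite -/c => /dvdpP[c' ec].
have nzc' : c' != 0 by apply: contraNneq nzc => c0; rewrite ec c0 mul0r.
have sc : (size c' + (k - j) + j <= n.+1)%N.
  have := leq_trans (tdsize_coef (shiftY p.2 g) j) (leq_trans (tdsize_shiftY _ _) sg).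
  rewrite -/c size_mulXn // ec size_mul ?expf_neq0 ?linX_neq0 // size_exp_XsubC addnS /=.
  by rewrite addnC.
have sc0 : (0 < size c')%N by rewrite size_poly_gt0.
have [|h hh eh] := @hom_exists (n - (k - j) - j) c'%:P.
  by rewrite tdsize_polyC; move: sc sc0; move: (size c') (k - j)%N; lia.
have lin_al : lin_at P (al - p.1 *: u).
  split; first by rewrite rpredB ?rpredZ.
  by rewrite mevalB mevalZ divfK ?subrr.
have lin_be : lin_at P (be - p.2 *: u).
  split; first by rewrite rpredB ?rpredZ.
  by rewrite mevalB mevalZ divfK ?subrr.
exists ((al - p.1 *: u) ^+ (k - j) * ((be - p.2 *: u) ^+ j * h)); split.
- have -> : n = ((k - j) + (j + (n - (k - j) - j)))%N.
    by move: sc sc0; move: (size c') (k - j)%N; lia.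
  by rewrite !dhomogM // homog1X //; [case: lin_al | case: lin_be].
- rewrite !(rmorphM dehom) !(rmorphXn dehom) !(rmorphB dehom) !dehomZ dehom_al dehom_be dehom_u !mulr1 eh ec.
  by rewrite [(c' * _)%:P]polyCM polyC_exp /linX polyCB [LHS]mulrA [LHS]mulrC mulrA.
apply: (@in_Ipow_le _ _ ((k - j) + (j + 0))); first by lia.
by do 2 apply: in_Ipow_exp => //; apply: in_Ipow0.
Qed.

End Point.
End Dehomogenization.

(** * Generic coordinates *)

Lemma common_nonroot (K : closedFieldType) (I : finType) (F : I -> {poly K}) :
  (forall i, F i != 0) -> exists x, forall i, (F i).[x] != 0.
Proof.
move=> nzF; have nzp : \prod_i F i != 0 by apply/prodf_neq0 => i _.
have [x] := poly_nonroot nzp; rewrite horner_prod => /prodf_neq0 nzx.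
by exists x => i; apply: nzx.
Qed.

Section GenericCoordinates.
Variables (K : closedFieldType) (b c : K).
Local Notation form := {mpoly K[3]}.

Definition gen_al : form := 'X_0 + c *: 'X_1.
Definition gen_be : form := 'X_1.
(** The lines with coefficients [(b^2, b, 1)] trace a conic in the dual plane, so a given point lies
    on at most two of them. *)
Definition gen_u : form := 'X_(2%:R) + b *: 'X_1 + b ^+ 2 *: 'X_0.

Definition gen_px (i : 'I_3) : K := if i == 0 then 1 else if i == 1 then 0 else - b ^+ 2.
Definition gen_py (i : 'I_3) : K :=
  if i == 0 then - c else if i == 1 then 1 else b ^+ 2 * c - b.
Definition gen_pz (i : 'I_3) : K := if i == 0 then 0 else if i == 1 then 0 else 1.

Lemma homogX (i : 'I_3) : ('X_i : form) \is 1.-homog.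
Proof. by rewrite dhomogX; apply/eqP/mdeg1. Qed.

Lemma gen_al_homog : gen_al \is 1.-homog.
Proof. by rewrite rpredD ?rpredZ ?homogX. Qed.

Lemma gen_be_homog : gen_be \is 1.-homog.
Proof. exact: homogX. Qed.

Lemma gen_u_homog : gen_u \is 1.-homog.
Proof. by rewrite !rpredD ?rpredZ ?homogX. Qed.

Lemma gen_XE i : 'X_i = gen_px i *: gen_al + gen_py i *: gen_be + gen_pz i *: gen_u.
Proof.
rewrite /gen_al /gen_be /gen_u /gen_px /gen_py /gen_pz -!mul_mpolyC.
case: (ord3P i) => -> /=; rewrite ?mpolyCN ?mpolyCD ?mpolyCB ?mpolyCM ?mpolyC_exp /=;
  rewrite ?mpolyC0 ?mpolyC1; ring.
Qed.

Local Notation gen_dehom := (dehom gen_px gen_py gen_pz).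

Lemma gen_dehomX i : gen_dehom 'X_i = affX gen_px gen_py gen_pz i.
Proof. by rewrite [LHS]mmapX mmap1U. Qed.

Lemma gen_dehom_be : gen_dehom gen_be = 'X.
Proof.
rewrite gen_dehomX /affX /gen_px /gen_py /gen_pz /=.
by rewrite scale0r !polyC0 add0r scale1r addr0.
Qed.

Lemma gen_dehom_al : gen_dehom gen_al = 'X%:P.
Proof.
rewrite rmorphD dehomZ -/gen_be gen_dehom_be gen_dehomX /affX /gen_px /gen_py /gen_pz /=.
by rewrite scale1r !polyC0 addr0 -mul_polyC !polyCN mulNr subrK.
Qed.

Lemma gen_dehom_u : gen_dehom gen_u = 1.
Proof.
have X0 : gen_dehom 'X_0 = 'X%:P - c%:P%:P * 'X.
  by rewrite -gen_dehom_al -gen_dehom_be -dehomZ -rmorphB addrK.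
rewrite !rmorphD !dehomZ -/gen_be gen_dehom_be X0 gen_dehomX.
rewrite /affX /gen_px /gen_py /gen_pz /= -!mul_polyC.
by rewrite !(polyCM, polyCN, polyCB, polyC_exp, polyC1); ring.
Qed.

End GenericCoordinates.

Section GenericChoice.
Variables (K : closedFieldType) (r : nat) (Z : 'I_r -> coords K).
Hypothesis Z_neq0 : forall s, nonzero_pt (Z s).

Lemma generic_infinity : exists b, forall s, (gen_u b).@[Z s] != 0.
Proof.
pose F s : {poly K} := (Z s 2%:R)%:P + Z s 1 *: 'X + Z s 0 *: 'X^2.
have coefF s i : (F s)`_i = Z s 2%:R *+ (i == 0)%N + Z s 1 *+ (i == 1)%N + Z s 0 *+ (i == 2)%N.
  rewrite !coefD !coefZ coefC coefX coefXn; case: i => [|[|[|i]]] //=;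
    by rewrite ?(mulr0, mulr1, mulr0n, mulr1n).
have [|b nzb] := @common_nonroot _ _ F.
  move=> s; apply/eqP => F0; have [i] := Z_neq0 s; apply/negP; rewrite negbK; apply/eqP.
  have e j : (F s)`_j = 0 by rewrite F0 coef0.
  have := e 0%N; have := e 1%N; have := e 2%N; rewrite !coefF /= !addr0 !add0r.
  by case: (ord3P i) => ->.
exists b => s; have -> : (gen_u b).@[Z s] = (F s).[b]; last exact: nzb.
by rewrite !mevalD !mevalZ !mevalXU !(hornerD, hornerZ, hornerC, hornerX, hornerXn); ring.
Qed.

(** The difference of two abscissas is a polynomial in [c] of degree at most one, whose coefficients
    are differences of affine coordinates; [c] avoids the roots of the nonzero ones. *)
Lemma generic_projection b : exists c, forall s t,
  let pt s := affpt (gen_al c) (gen_be K) (gen_u b) (Z s) in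
  (pt s).1 = (pt t).1 -> pt s = pt t.
Proof.
pose u s := (gen_u b).@[Z s].
pose d (st : 'I_r * 'I_r) : {poly K} :=
  (Z st.1 0 / u st.1 - Z st.2 0 / u st.2)%:P + (Z st.1 1 / u st.1 - Z st.2 1 / u st.2) *: 'X.
(* A zero polynomial means that the two points coincide in the chart; the value 1 exempts such
   pairs, among them [s = t]. *)
have [|c nzc] := @common_nonroot _ _ (fun st => if d st == 0 then 1 else d st).
  by move=> st; case: ifPn => // _; rewrite oner_eq0.
exists c => s t /= e; have := nzc (s, t).
have dc : (d (s, t)).[c] = 0.
  have alE i : (gen_al c).@[Z i] = Z i 0 + c * Z i 1 by rewrite mevalD mevalZ !mevalXU.
  move/eqP: e; rewrite -subr_eq0 !alE => /eqP <-.
  by rewrite !(hornerD, hornerZ, hornerC, hornerX) /u /=; ring.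
case: ifP => [/eqP/(congr1 (fun q : {poly K} => q`_1)) d0 _|_]; last by rewrite dc eqxx.
move: d0; rewrite coefD coefC coefZ coefX mulr1 add0r coef0 => /subr0_eq d0.
by rewrite /affpt; congr (_, _) => //; rewrite !mevalXU.
Qed.

End GenericChoice.

(** * Transfer from the affine chart to the projective plane *)

Theorem theorem3p4 (K : closedFieldType) (Hchar : [pchar K] =i pred0)
    (r : nat) (Z : 'I_r -> coords K) (HZ : forall s, nonzero_pt (Z s))
    (k : nat) (Hk : (2 <= k)%N) (a : nat)
    (Ha1 : is_alpha (in_IkZ Z k.-1) a)
    (Ha2 : is_alpha (in_IkZ Z k) a.+1) :
  collinear Z \/ exists (m : nat) (L : 'I_m -> {mpoly K[3]}), is_intersection_set Z L.
Proof.
have [b nzu] := generic_infinity HZ; have [c inj_pt] := generic_projection Z b.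
pose al := gen_al c; pose be := gen_be K; pose u := gen_u b.
pose D := dehom (gen_px b) (gen_py b c) (@gen_pz K).
pose pt s := affpt al be u (Z s).
have D_hom n := hom_exists (gen_al_homog c) (gen_be_homog K) (gen_u_homog b)
  (gen_dehom_al b c) (gen_dehom_be b c) (gen_dehom_u b c) (n := n).
have D_inj n := dehom_inj (gen_XE b c) (gen_dehom_u b c) (n := n).
have D_Ipow s := in_Ipow_dehom (gen_al_homog c) (gen_be_homog K) (gen_u_homog b)
  (gen_XE b c) (gen_dehom_al b c) (gen_dehom_be b c) (gen_dehom_u b c) (nzu s).
have D_mult s := mult_ge_dehom (gen_XE b c) (nzu s).
have D_lin s := mult_ge_dehom_lin (gen_XE b c) (nzu s).
have D0 n f : f \is n.-homog -> f != 0 -> D f != 0.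
  exact: (dehom_neq0 (gen_XE b c) (gen_dehom_u b c)).
(* [Z] may list a point several times, whereas the affine argument needs distinct abscissas. *)
pose S := undup [seq pt s | s <- enum 'I_r].
have ptS s : pt s \in S by rewrite mem_undup map_f // mem_enum.
have Spt p : p \in S -> exists s, p = pt s.
  by rewrite mem_undup => /mapP[s _ ->]; exists s.
have uniqS : uniq (map fst S).
  rewrite map_inj_in_uniq ?undup_uniq // => p q /Spt[s ->] /Spt[t ->].
  exact: inj_pt.
have [[f [nzf [hf If]]] min_f] := Ha2.
(* If the degree dropped in the chart, [D f] would lift to a nonzero form of degree [a] in the ideal
   of [kZ], below its initial degree. *)
have tdf : tdsize (D f) = a.+2.
  apply/eqP; rewrite eqn_leq (tdsize_dehom _ _ _ hf) andTb ltnNge.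
  apply/negP => /D_hom[f' hf' ef'].
  have f'0 : f' = 0.
    apply: (min_f a) => // s; apply: D_Ipow hf' _.
    by rewrite ef'; apply: D_mult.
  by have := D0 _ _ hf nzf; rewrite -ef' f'0 rmorph0 eqxx.
(* For [a = 0] only [g = 0] qualifies; otherwise [g] lifts to a form of degree [a - 1], below the
   initial degree for [k - 1]. *)
have min_g g : (tdsize g <= a)%N -> {in S, forall p, mult_ge p k.-1 g} -> g = 0.
  have [_] := Ha1; case: (a) => [|a'] min_a.
    by rewrite leqn0 tdsize_eq0 => /eqP.
  move=> /D_hom[f' hf' <-] mg; rewrite [f'](min_a a') ?rmorph0 // => s.
  by apply: D_Ipow hf' _; apply: mg; apply: ptS.
have mult_f : {in S, forall p, mult_ge p k (D f)}.
  by move=> p /Spt[s ->]; apply: D_mult.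
have [ls [/allP sl alt]] := affine_arrangement Hchar uniqS (ltnW Hk) min_g tdf mult_f.
have lift_line l : l \in ls -> exists2 L, is_line L & D L = l.
  move=> /sl/eqP tdl; have [L hL eL] := D_hom 1%N l (eq_leq tdl).
  have nzl : l != 0 by rewrite -tdsize_eq0 tdl.
  by exists L => //; split=> //; apply: contraNneq nzl => L0; rewrite -eL L0 rmorph0.
case: alt => [[l l_in on_l]|[pairs meets]]; [left | right].
  have [L [nzL hL] eL] := lift_line l l_in; exists L; split=> //; split=> // s.
  by apply/eqP; rewrite -(D_lin s _ hL) -/D eL; apply: on_l (ptS s).
have /fin_all_exists[L LP] (i : 'I_(size ls)) :
    exists L, is_line L /\ D L = nth 0 ls i.
  have [L hL eL] := lift_line _ (mem_nth 0 (ltn_ord i)).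
  by exists L.
have L_on i s : (L i).@[Z s] = 0 <-> on_line (pt s) (nth 0 ls i).
  have [[nzL hL] <-] := LP i; rewrite /on_line (D_lin s _ hL).
  by split=> /eqP.
have L_same i j : same_line (L i) (L j) <-> proportional (nth 0 ls i) (nth 0 ls j).
  have [[_ hi] <-] := LP i; have [[_ hj] <-] := LP j; split=> [[t [nzt ->]]|[t nzt e]].
    by exists t => //; rewrite dehomZ.
  exists t; split=> //; apply: (D_inj 1%N) => //; first exact: rpredZ.
  by rewrite dehomZ.
exists (size ls), L; split=> [i|]; first by case: (LP i).
split=> [s|P nzP [i [j [nsame [Pi Pj]]]]].
  have [l [l' [l_in l'_in on_l on_l' npar]]] := pairs _ (ptS s).
  have lti : (index l ls < size ls)%N by rewrite index_mem.
  have ltj : (index l' ls < size ls)%N by rewrite index_mem.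
  exists (Ordinal lti), (Ordinal ltj); split; first by move/L_same; rewrite !nth_index.
  by split; apply/L_on; rewrite nth_index.
have npar : ~ proportional (nth 0 ls i) (nth 0 ls j) by move/L_same.
have [p /Spt[s ->] /andP[on_i on_j]] :=
  meets _ _ (mem_nth 0 (ltn_ord i)) (mem_nth 0 (ltn_ord j)) npar.
(* [P] is not assumed to lie in the chart. The two lines already meet at [Z s], and the uniqueness
   of their common point identifies it with [P], so no intersection is left at infinity. *)
exists s; apply: (@lines_meet_once _ (L i) (L j)) => //.
- by case: (LP i).
- by case: (LP j).
- exact/L_on.
exact/L_on.
Qed.
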